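(* Let $p:\mathbb{E}\to\mathbb{B}$ be a fibred type-theoretic fibration category. Then each fiber $\mathbb{E}_I$ is a type-theoretic fibration category, restricting the structure of $\mathbb{E}$ (the fibrations of $\mathbb{E}_I$ are the morphisms of $\mathbb{E}_I$ that are fibrations in $\mathbb{E}$), and all of the following hold. \begin{enumerate} \item The base category $\mathbb{B}$ and all fibers $\mathbb{E}_I$ are type-theoretic fibration categories. \item For every morphism $s:I\to J$ in $\mathbb{B}$, the reindexing functor $s^*:\mathbb{E}_J\to\mathbb{E}_I$ is a type-theoretic functor. \item For every acyclic cofibration $s:I\to J$ in $\mathbb{B}$, every fibration in $\mathbb{E}_J$ is weakly $s^*$-cartesian. \item For any fibration $s:I\to J$ in $\mathbb{B}$, the reindexing functor $s^*:\mathbb{E}_J\to\mathbb{E}_I$ has a right adjoint $s_*$ preserving fibrations. Moreover, the Beck-Chevalley condition holds: if $s':I'\to J'$ is the pullback of a fibration $s:I\to J$ along $r:J'\to J$, with upper morphism $t:I'\to I$, then the canonical natural transformation $r^*s_*\Rightarrow s'_*t^*$ is an isomorphism. \end{enumerate}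
   Context: A morphism $i:A\to B$ has the left lifting property with respect to $q:C\to D$ if for all $f:A\to C$, $g:B\to D$ with $qf=gi$ there is $h:B\to C$ with $hi=f$ and $qh=g$. A type-theoretic fibration category is a category $\mathbb{C}$ with a terminal object $1$ and a subcategory whose morphisms are called fibrations, such that (an acyclic cofibration being a morphism with the left lifting property with respect to all fibrations): (i) all isomorphisms and all morphisms with codomain $1$ are fibrations; (ii) pullbacks of fibrations along arbitrary morphisms exist and are fibrations; (iii) every morphism factors as an acyclic cofibration followed by a fibration; (iv) for any fibrations $f:A\to B$ and $g:B\to C$ there is a fibration $\Pi_gf:\Pi_gA\to C$, called a dependent product of $f$ along $g$, with a natural bijection $(\mathbb{C}/C)(h,\Pi_gf)\cong(\mathbb{C}/B)(g^*h,f)$ for all $h:X\to C$. A type-theoretic functor is a functor between type-theoretic fibration categories preserving terminal objects, fibrations, pullbacks of fibrations, acyclic cofibrations and dependent products. A fibred category $p:\mathbb{E}\to\mathbb{B}$ is a Grothendieck fibration; $\mathbb{E}_I$ is the fiber over $I$, and a morphism $f$ is above $s$ if $pf=s$. A fibred type-theoretic fibration category is a fibred category $p:\mathbb{E}\to\mathbb{B}$ such that: (1) $\mathbb{E}$ and $\mathbb{B}$ are type-theoretic fibration categories and $p$ is a type-theoretic functor; (2) every cartesian morphism above a fibration is a fibration; (3) if $g:A\to C$ is a fibration in $\mathbb{E}$, $pg=t\circ s$ with $s:pA\to J$ a fibration and $t:J\to pC$, then the induced morphism $A\to t^*C$ above $s$ is a fibration; (4) every cartesian morphism above an acyclic cofibration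 is an acyclic cofibration. For a functor $q:\mathbb{C}\to\mathbb{D}$, a morphism $f:A\to B$ of $\mathbb{C}$ is weakly $q$-cartesian if for all $g:X\to B$ in $\mathbb{C}$ and $s:qX\to qA$ with $qf\circ s=qg$ there exists $h:X\to A$ with $f\circ h=g$ and $qh=s$. *)

(* Defs.v *)
From Corelib Require Export ssreflect ssrfun.
From Stdlib Require Import ProofIrrelevance IndefiniteDescription.

Set Implicit Arguments.
Unset Strict Implicit.
Unset Printing Implicit Defensive.

Declare Scope cat_scope.
Delimit Scope cat_scope with cat.
Local Open Scope cat_scope.

Record Category : Type := {
  Obj :> Type;
  Hom : Obj -> Obj -> Type;
  idm : forall A, Hom A A;
  comp : forall A B C, Hom B C -> Hom A B -> Hom A C;
  comp1m : forall A B (f : Hom A B), comp (idm B) f = f;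
  compm1 : forall A B (f : Hom A B), comp f (idm A) = f;
  compA : forall A B C D (h : Hom C D) (g : Hom B C) (f : Hom A B),
    comp h (comp g f) = comp (comp h g) f }.

Arguments Hom {c} A B.
Arguments idm {c} A.
Arguments comp {c A B C} g f.
Notation "g ∘ f" := (comp g f) (at level 40, left associativity) : cat_scope.

Record Functor (C D : Category) : Type := {
  fobj :> C -> D;
  fmap : forall A B : C, Hom A B -> Hom (fobj A) (fobj B);
  fmap1 : forall A : C, fmap (idm A) = idm (fobj A);
  fmapM : forall (X Y Z : C) (g : Hom Y Z) (f : Hom X Y),
    fmap (g ∘ f) = fmap g ∘ fmap f }.

Arguments fmap {C D} F {A B} f : rename.

Definition id_functor (C : Category) : Functor C C :=
  {| fobj := fun A => A; fmap := fun A B f => f;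
     fmap1 := fun A => erefl; fmapM := fun X Y Z g f => erefl |}.

Definition comp_functor (C D K : Category) (G : Functor D K) (F : Functor C D) :
  Functor C K.
Proof.
refine {| fobj := fun A => G (F A); fmap := fun A B f => fmap G (fmap F f) |}.
- by move=> A; rewrite !fmap1.
- by move=> X Y Z g f; rewrite !fmapM.
Defined.

Record NatTrans (C D : Category) (F G : Functor C D) : Type := {
  nt_comp :> forall A : C, Hom (F A) (G A);
  nt_natural : forall (A B : C) (f : Hom A B),
    nt_comp B ∘ fmap F f = fmap G f ∘ nt_comp A }.

Lemma paste_squares (C : Category) (X Y Z X' Y' Z' : C) (f : Hom X Y) (g : Hom Y Z)
    (f' : Hom X' Y') (g' : Hom Y' Z') (x : Hom X X') (y : Hom Y Y') (z : Hom Z Z') :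
  f' ∘ x = y ∘ f -> g' ∘ y = z ∘ g -> g' ∘ f' ∘ x = z ∘ (g ∘ f).
Proof. by move=> e1 e2; rewrite -compA e1 compA e2 compA. Qed.

Definition is_iso (C : Category) (A B : C) (f : Hom A B) : Prop :=
  exists g : Hom B A, g ∘ f = idm A /\ f ∘ g = idm B.

Definition is_nat_iso (C D : Category) (F G : Functor C D) (a : NatTrans F G) :
  Prop := forall A : C, is_iso (a A).

(** [Adjunction F G] : [F] is left adjoint to [G]. *)
Record Adjunction (C D : Category) (F : Functor C D) (G : Functor D C) : Type := {
  adj_unit : NatTrans (id_functor C) (comp_functor G F);
  adj_counit : NatTrans (comp_functor F G) (id_functor D);
  adj_triangle_l : forall A : C,
    adj_counit (F A) ∘ fmap F (adj_unit A) = idm (F A);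
  adj_triangle_r : forall X : D,
    fmap G (adj_counit X) ∘ adj_unit (G X) = idm (G X) }.

Definition is_terminal (C : Category) (T : C) : Prop :=
  forall A : C, exists! f : Hom A T, True.

(** The square with sides [q1 : P -> X], [q2 : P -> Y] over the cospan
    [f : X -> Z], [g : Y -> Z] is a pullback. *)
Definition is_pullback (C : Category) (X Y Z P : C)
    (q1 : Hom P X) (q2 : Hom P Y) (f : Hom X Z) (g : Hom Y Z) : Prop :=
  f ∘ q1 = g ∘ q2 /\
  forall (W : C) (a : Hom W X) (b : Hom W Y), f ∘ a = g ∘ b ->
    exists! w : Hom W P, q1 ∘ w = a /\ q2 ∘ w = b.

(** Morphisms [h -> k] of the slice category over [Z]. *)
Definition slice_hom (C : Category) (Z X Y : C) (h : Hom X Z) (k : Hom Y Z) : Type :=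
  {m : Hom X Y | k ∘ m = h}.

Definition has_llp (C : Category) (A B X Y : C) (i : Hom A B) (q : Hom X Y) : Prop :=
  forall (f : Hom A X) (g : Hom B Y), q ∘ f = g ∘ i ->
    exists h : Hom B X, h ∘ i = f /\ q ∘ h = g.

Definition MorClass (C : Category) : Type := forall A B : C, Hom A B -> Prop.

Definition acyclic_cof (C : Category) (fib : MorClass C) : MorClass C :=
  fun A B i => forall (X Y : C) (q : Hom X Y), fib X Y q -> has_llp i q.

(** [pi : D -> Z] is a dependent product of [f : A -> B] along [g : B -> Z].
    A value [g^* h] is given by any pullback square [(q1, q2)] of [h] and [g],
    with [q2] as its structure map; the bijection is indexed by all such choices
    and natural with respect to the maps [w] that morphisms [m : h' -> h] of the
    slice over [Z] induce between them. *)
Record DepProd (C : Category) (A B Z D : C)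
    (f : Hom A B) (g : Hom B Z) (pi : Hom D Z) : Type := {
  dp_bij : forall (X P : C) (h : Hom X Z) (q1 : Hom P X) (q2 : Hom P B),
    is_pullback q1 q2 h g -> slice_hom h pi -> slice_hom q2 f;
  dp_bijective : forall (X P : C) (h : Hom X Z) (q1 : Hom P X) (q2 : Hom P B)
    (pb : is_pullback q1 q2 h g), bijective (dp_bij pb);
  dp_natural : forall (X X' P P' : C) (h : Hom X Z) (h' : Hom X' Z)
    (q1 : Hom P X) (q2 : Hom P B) (q1' : Hom P' X') (q2' : Hom P' B)
    (pb : is_pullback q1 q2 h g) (pb' : is_pullback q1' q2' h' g)
    (m : Hom X' X) (w : Hom P' P) (k : slice_hom h pi) (k' : slice_hom h' pi),
    h ∘ m = h' -> q1 ∘ w = m ∘ q1' -> q2 ∘ w = q2' ->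
    sval k' = sval k ∘ m ->
    sval (dp_bij pb' k') = sval (dp_bij pb k) ∘ w }.

Record is_ttfc (C : Category) (fib : MorClass C) : Prop := {
  ttfc_terminal : exists T : C, is_terminal T;
  ttfc_fib_comp : forall (X Y Z : C) (g : Hom Y Z) (f : Hom X Y),
    fib Y Z g -> fib X Y f -> fib X Z (g ∘ f);
  ttfc_fib_iso : forall (A B : C) (f : Hom A B), is_iso f -> fib A B f;
  ttfc_fib_terminal : forall (A T : C) (f : Hom A T), is_terminal T -> fib A T f;
  ttfc_pullback : forall (X Y Z : C) (f : Hom X Z) (g : Hom Y Z), fib X Z f ->
    exists (P : C) (q1 : Hom P X) (q2 : Hom P Y), is_pullback q1 q2 f g;
  ttfc_pullback_fib : forall (X Y Z P : C) (q1 : Hom P X) (q2 : Hom P Y)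
    (f : Hom X Z) (g : Hom Y Z), is_pullback q1 q2 f g -> fib X Z f -> fib P Y q2;
  ttfc_factor : forall (A B : C) (f : Hom A B),
    exists (M : C) (i : Hom A M) (q : Hom M B),
      acyclic_cof fib i /\ fib M B q /\ q ∘ i = f;
  ttfc_dep_prod : forall (A B Z : C) (f : Hom A B) (g : Hom B Z),
    fib A B f -> fib B Z g ->
    exists (D : C) (pi : Hom D Z), fib D Z pi /\ inhabited (DepProd f g pi) }.

Definition preserves_fib (C D : Category) (fibC : MorClass C) (fibD : MorClass D)
    (F : Functor C D) : Prop :=
  forall (A B : C) (f : Hom A B), fibC A B f -> fibD (F A) (F B) (fmap F f).

Definition preserves_terminal (C D : Category) (F : Functor C D) : Prop :=
  forall T : C, is_terminal T -> is_terminal (F T).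

Definition preserves_pullback_fib (C D : Category) (fibC : MorClass C)
    (F : Functor C D) : Prop :=
  forall (X Y Z P : C) (q1 : Hom P X) (q2 : Hom P Y) (f : Hom X Z) (g : Hom Y Z),
    fibC X Z f -> is_pullback q1 q2 f g ->
    is_pullback (fmap F q1) (fmap F q2) (fmap F f) (fmap F g).

(** Preservation is meant canonically: [F pi] is a dependent product through a
    natural bijection that extends the image under [F] of the given one. *)
Definition preserves_dep_prod (C D : Category) (fibC : MorClass C)
    (F : Functor C D) : Prop :=
  forall (A B Z D' : C) (f : Hom A B) (g : Hom B Z) (pi : Hom D' Z),
    fibC A B f -> fibC B Z g -> fibC D' Z pi -> forall d : DepProd f g pi,
    exists d' : DepProd (fmap F f) (fmap F g) (fmap F pi),
      forall (X P : C) (h : Hom X Z) (q1 : Hom P X) (q2 : Hom P B)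
        (pb : is_pullback q1 q2 h g)
        (pb' : is_pullback (fmap F q1) (fmap F q2) (fmap F h) (fmap F g))
        (k : slice_hom h pi) (k' : slice_hom (fmap F h) (fmap F pi)),
        sval k' = fmap F (sval k) ->
        sval (dp_bij d' pb' k') = fmap F (sval (dp_bij d pb k)).

Record is_tt_functor (C D : Category) (fibC : MorClass C) (fibD : MorClass D)
    (F : Functor C D) : Prop := {
  ttf_dom : is_ttfc fibC;
  ttf_cod : is_ttfc fibD;
  ttf_terminal : preserves_terminal F;
  ttf_fib : preserves_fib fibC fibD F;
  ttf_pullback : preserves_pullback_fib fibC F;
  ttf_acyclic_cof : preserves_fib (acyclic_cof fibC) (acyclic_cof fibD) F;
  ttf_dep_prod : preserves_dep_prod fibC F }.

Definition weakly_cartesian (C D : Category) (q : Functor C D) (A B : C)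
    (f : Hom A B) : Prop :=
  forall (X : C) (g : Hom X B) (s : Hom (q X) (q A)), fmap q f ∘ s = fmap q g ->
    exists h : Hom X A, f ∘ h = g /\ fmap q h = s.

Definition cartesian (E B : Category) (p : Functor E B) (A A' : E) (f : Hom A A') :
    Prop :=
  forall (X : E) (g : Hom X A') (s : Hom (p X) (p A)), fmap p f ∘ s = fmap p g ->
    exists! h : Hom X A, f ∘ h = g /\ fmap p h = s.

(** Equality of base objects is propositional: a morphism of [B] is transported
    along such equalities before it is compared with one of [Hom I J]. *)
Definition hcast (B : Category) (a b I J : B) (ea : a = I) (eb : b = J)
    (f : Hom a b) : Hom I J :=
  match ea in _ = I', eb in _ = J' return Hom I' J' with
  | erefl, erefl => f
  end.

Section Fibred.
Variables (E B : Category) (p : Functor E B).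

Record FibObj (I : B) : Type := { fo_obj :> E; fo_eq : p fo_obj = I }.

Definition above (I J : B) (A : FibObj I) (A' : FibObj J) (f : Hom A A')
    (s : Hom I J) : Prop :=
  hcast (fo_eq A) (fo_eq A') (fmap p f) = s.

Definition is_fibration : Prop :=
  forall (I J : B) (s : Hom I J) (A : FibObj J),
    exists (A' : FibObj I) (f : Hom A' A), cartesian p f /\ above f s.

Lemma above_id (I : B) (A : FibObj I) : above (idm (A : E)) (idm I).
Proof. by case: A => A e; case: I / e; rewrite /above /= fmap1. Qed.

Lemma above_comp (I J K : B) (X : FibObj I) (Y : FibObj J) (Z : FibObj K)
    (g : Hom Y Z) (f : Hom X Y) (t : Hom J K) (s : Hom I J) :
  above g t -> above f s -> above (g ∘ f) (t ∘ s).
Proof.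
case: X f => X eX; case: Y g => Y eY; case: Z => Z eZ; rewrite /above /=.
by destruct eX, eY, eZ => /= g f <- <-; rewrite fmapM.
Qed.

Lemma cartesian_above (I J K : B) (A : FibObj I) (A' : FibObj J) (X : FibObj K)
    (f : Hom A A') (s : Hom I J) (g : Hom X A') (r : Hom K I) :
  cartesian p f -> above f s -> above g (s ∘ r) ->
  exists! h : Hom X A, f ∘ h = g /\ above h r.
Proof.
case: X g => X eX; case: A' f => A' eA'; case: A => A eA; rewrite /above /=.
by destruct eX, eA, eA' => /= f g cf <- e; apply: cf.
Qed.

Definition FibHom (I : B) (A A' : FibObj I) : Type :=
  {f : Hom (A : E) (A' : E) | above f (idm I)}.

Lemma above_vcomp (I J : B) (X Y : FibObj I) (Z : FibObj J) (g : Hom Y Z)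
    (f : Hom X Y) (s : Hom I J) :
  above g s -> above f (idm I) -> above (g ∘ f) s.
Proof. by move=> ag af; rewrite -(compm1 s); apply: above_comp. Qed.

Lemma above_vcompl (I J : B) (X : FibObj I) (Y Z : FibObj J) (g : Hom Y Z)
    (f : Hom X Y) (s : Hom I J) :
  above g (idm J) -> above f s -> above (g ∘ f) s.
Proof. by move=> ag af; rewrite -(comp1m s); apply: above_comp. Qed.

Lemma FibHom_eq (I : B) (A A' : FibObj I) (f g : FibHom A A') :
  sval f = sval g -> f = g.
Proof.
case: f g => [f af] [g ag] /= e; subst g.
by rewrite (proof_irrelevance _ af ag).
Qed.

Definition fiber (I : B) : Category.
Proof.
unshelve refine {| Obj := FibObj I; Hom := @FibHom I;
  idm := fun A => exist _ (idm (A : E)) (above_id A);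
  comp := fun X Y Z g f =>
    exist _ (sval g ∘ sval f) (above_vcomp (svalP g) (svalP f)) |}.
- by move=> A A' f; apply: FibHom_eq; rewrite /= comp1m.
- by move=> A A' f; apply: FibHom_eq; rewrite /= compm1.
- by move=> X Y Z W h g f; apply: FibHom_eq; rewrite /= compA.
Defined.

Definition fiber_fib (fibE : MorClass E) (I : B) : MorClass (fiber I) :=
  fun A A' f => fibE _ _ (sval f).

(** The functor [s^*] depends on a choice of cartesian liftings. *)
Record Cleavage : Type := {
  cl_obj : forall (I J : B), Hom I J -> FibObj J -> FibObj I;
  cl_lift : forall (I J : B) (s : Hom I J) (A : FibObj J), Hom (cl_obj s A) A;
  cl_cartesian : forall (I J : B) (s : Hom I J) (A : FibObj J),
    cartesian p (cl_lift s A);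
  cl_above : forall (I J : B) (s : Hom I J) (A : FibObj J), above (cl_lift s A) s }.

Arguments cl_cartesian _ {I J} _ _ [X] _ _ _.
Arguments cl_above _ {I J} _ _.

Lemma fibration_cleavage : is_fibration -> inhabited Cleavage.
Proof.
move=> H.
have c (I J : B) (s : Hom I J) (A : FibObj J) :
    {A' : FibObj I & {f : Hom A' A | cartesian p f /\ above f s}}.
  have [A' HA'] := constructive_indefinite_description _ (H I J s A).
  by exists A'; apply: constructive_indefinite_description.
split; exists (fun I J s A => projT1 (c I J s A))
              (fun I J s A => sval (projT2 (c I J s A))) => I J s A.
- by case: (svalP (projT2 (c I J s A))).
- by case: (svalP (projT2 (c I J s A))).
Qed.

Variable cl : Cleavage.

(** The morphism [X -> s^* A] above [r] induced by [g : X -> A] above [s ∘ r]. *)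
Definition cl_factor (I J K : B) (s : Hom I J) (r : Hom K I) (A : FibObj J)
    (X : FibObj K) (g : Hom X A) (ag : above g (s ∘ r)) :
  {h : Hom X (cl_obj cl s A) | cl_lift cl s A ∘ h = g /\ above h r}.
Proof.
apply: constructive_indefinite_description.
have [h [Hh _]] := cartesian_above (cl_cartesian cl s A) (cl_above cl s A) ag.
by exists h.
Defined.

Lemma cl_factor_uniq (I J K : B) (s : Hom I J) (r : Hom K I) (A : FibObj J)
    (X : FibObj K) (h h' : Hom X (cl_obj cl s A)) :
  above h r -> above h' r ->
  cl_lift cl s A ∘ h = cl_lift cl s A ∘ h' -> h = h'.
Proof.
move=> ah ah' e.
have ag := above_comp (cl_above cl s A) ah.
have [k [_ Hk]] := cartesian_above (cl_cartesian cl s A) (cl_above cl s A) ag.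
by rewrite -(Hk h) // -(Hk h').
Qed.

Section Reindex.
Variables (I J : B) (s : Hom I J).

Lemma reindex_above (A A' : FibObj J) (f : FibHom A A') :
  above (sval f ∘ cl_lift cl s A) (s ∘ idm I).
Proof.
by rewrite compm1; apply: above_vcompl (svalP f) (cl_above cl s A).
Qed.

(** The unique vertical [h] with [cl_lift s A' ∘ h = f ∘ cl_lift s A]. *)
Definition reindex_mor (A A' : FibObj J) (f : FibHom A A') :
    FibHom (cl_obj cl s A) (cl_obj cl s A') :=
  exist _ (sval (cl_factor (reindex_above f)))
          (proj2 (svalP (cl_factor (reindex_above f)))).

Lemma reindex_morE (A A' : FibObj J) (f : FibHom A A') :
  cl_lift cl s A' ∘ sval (reindex_mor f) = sval f ∘ cl_lift cl s A.
Proof. exact: proj1 (svalP (cl_factor (reindex_above f))). Qed.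

Definition reindex : Functor (fiber J) (fiber I).
Proof.
refine {| fobj := (cl_obj cl s : fiber J -> fiber I);
          fmap := fun (A A' : fiber J) (f : Hom A A') =>
            (reindex_mor f : Hom (_ : fiber I) _) |}.
- move=> A; apply: FibHom_eq; apply: (@cl_factor_uniq _ _ _ s (idm I)).
  + exact: svalP (reindex_mor (idm (A : fiber J))).
  + exact: above_id.
  + by apply: etrans (reindex_morE _) _; rewrite /= comp1m compm1.
- move=> X Y Z g f; apply: FibHom_eq; apply: (@cl_factor_uniq _ _ _ s (idm I)).
  + exact: svalP (reindex_mor (g ∘ f)).
  + exact: above_vcomp (svalP (reindex_mor g)) (svalP (reindex_mor f)).
  + apply: etrans (reindex_morE _) _.
    change (sval g ∘ sval f ∘ cl_lift cl s X =
            cl_lift cl s Z ∘ (sval (reindex_mor g) ∘ sval (reindex_mor f))).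
    by rewrite compA (reindex_morE g) -compA -(reindex_morE f) compA.
Defined.

End Reindex.

Section BeckChevalley.
Variables (I J I' J' : B).
Variables (s : Hom I J) (r : Hom J' J) (t : Hom I' I) (s' : Hom I' J').
Hypothesis sq : s ∘ t = r ∘ s'.

Section Component.
Variable A : FibObj J.

Lemma reindex_sq_above1 :
  above (cl_lift cl r A ∘ cl_lift cl s' (cl_obj cl r A)) (s ∘ t).
Proof. by rewrite sq; apply: above_comp; apply: cl_above. Qed.

Lemma reindex_sq_above2 : above (sval (cl_factor reindex_sq_above1)) (t ∘ idm I').
Proof. by rewrite compm1; case: (svalP (cl_factor reindex_sq_above1)). Qed.

(** The canonical vertical comparison [s'^* r^* A -> t^* s^* A]: the unique one
    commuting with the cartesian liftings to [A]. *)
Definition reindex_sq_comp :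
    FibHom (cl_obj cl s' (cl_obj cl r A)) (cl_obj cl t (cl_obj cl s A)) :=
  exist _ (sval (cl_factor reindex_sq_above2))
          (proj2 (svalP (cl_factor reindex_sq_above2))).

Lemma reindex_sq_compE :
  cl_lift cl s A ∘ (cl_lift cl t (cl_obj cl s A) ∘ sval reindex_sq_comp) =
  cl_lift cl r A ∘ cl_lift cl s' (cl_obj cl r A).
Proof.
rewrite /= (proj1 (svalP (cl_factor reindex_sq_above2))).
exact: proj1 (svalP (cl_factor reindex_sq_above1)).
Qed.

End Component.

Definition reindex_sq :
  NatTrans (comp_functor (reindex s') (reindex r))
           (comp_functor (reindex t) (reindex s)).
Proof.
refine (Build_NatTrans (F := comp_functor (reindex s') (reindex r))
  (G := comp_functor (reindex t) (reindex s)) (nt_comp := reindex_sq_comp) _).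
move=> X Y f; apply: FibHom_eq; apply: (@cl_factor_uniq _ _ _ t (idm I')).
- exact: above_vcomp (svalP (reindex_sq_comp Y))
                     (svalP (reindex_mor s' (reindex_mor r f))).
- exact: above_vcomp (svalP (reindex_mor t (reindex_mor s f)))
                     (svalP (reindex_sq_comp X)).
- have aX : above (cl_lift cl t (cl_obj cl s Y)) t by apply: cl_above.
  apply: (@cl_factor_uniq _ _ _ s t).
  + apply: above_vcomp aX _.
    exact: above_vcomp (svalP (reindex_sq_comp Y))
                       (svalP (reindex_mor s' (reindex_mor r f))).
  + apply: above_vcomp aX _.
    exact: above_vcomp (svalP (reindex_mor t (reindex_mor s f)))
                       (svalP (reindex_sq_comp X)).
  + transitivity (sval f ∘ (cl_lift cl r X ∘ cl_lift cl s' (cl_obj cl r X))).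
    * change (cl_lift cl s Y ∘ (cl_lift cl t _ ∘ (sval (reindex_sq_comp Y) ∘
        sval (reindex_mor s' (reindex_mor r f)))) =
        sval f ∘ (cl_lift cl r X ∘ cl_lift cl s' (cl_obj cl r X))).
      rewrite (compA (cl_lift cl t _)) (compA (cl_lift cl s _)).
      rewrite (reindex_sq_compE Y) -compA.
      rewrite (reindex_morE s' (reindex_mor r f)) compA.
      by rewrite (reindex_morE r f) compA.
    * change (sval f ∘ (cl_lift cl r X ∘ cl_lift cl s' (cl_obj cl r X)) =
        cl_lift cl s Y ∘ (cl_lift cl t _ ∘ (sval (reindex_mor t (reindex_mor s f)) ∘
        sval (reindex_sq_comp X)))).
      rewrite (compA (cl_lift cl t _)).
      rewrite (reindex_morE t (reindex_mor s f)) -compA (compA (cl_lift cl s _)).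
      by rewrite (reindex_morE s f) -compA reindex_sq_compE.
Defined.

Variables (sR : Functor (fiber I) (fiber J)) (adj : Adjunction (reindex s) sR).
Variables (sR' : Functor (fiber I') (fiber J')) (adj' : Adjunction (reindex s') sR').

(** The mate [r^* s_* => s'_* s'^* r^* s_* ≅ s'_* t^* s^* s_* => s'_* t^*]. *)
Definition beck_chevalley :
  NatTrans (comp_functor (reindex r) sR) (comp_functor sR' (reindex t)).
Proof.
unshelve refine (Build_NatTrans (F := comp_functor (reindex r) sR)
  (G := comp_functor sR' (reindex t)) (nt_comp := fun A : fiber I =>
  fmap sR' (fmap (reindex t) (adj_counit adj A)) ∘ fmap sR' (reindex_sq (sR A))
    ∘ adj_unit adj' (reindex r (sR A))) _).
move=> X Y f.
have Hq := etrans (esym (fmapM sR' _ _))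
  (etrans (congr1 (fun h => fmap sR' h) (nt_natural reindex_sq (fmap sR f)))
          (fmapM sR' _ _)).
have He' := etrans (esym (fmapM (reindex t) _ _))
  (etrans (congr1 (fun h => fmap (reindex t) h) (nt_natural (adj_counit adj) f))
          (fmapM (reindex t) _ _)).
have He := etrans (esym (fmapM sR' _ _))
  (etrans (congr1 (fun h => fmap sR' h) He') (fmapM sR' _ _)).
exact: paste_squares (nt_natural (adj_unit adj') (fmap (reindex r) (fmap sR f)))
                     (paste_squares Hq He).
Defined.

End BeckChevalley.

End Fibred.

Arguments fiber {E B} p I.
Arguments fiber_fib {E B} p fibE I A A' f : rename.

(** The base object [J] and the lifting [c] of [t] in [fttfc_induced_fib] are
    arbitrary: [T] plays the role of [t^* C] and [u] that of the induced map. *)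
Record is_fibred_ttfc (E B : Category) (fibE : MorClass E) (fibB : MorClass B)
    (p : Functor E B) : Prop := {
  fttfc_fibration : is_fibration p;
  fttfc_tt_functor : is_tt_functor fibE fibB p;
  fttfc_cart_fib : forall (A C : E) (f : Hom A C),
    cartesian p f -> fibB (p A) (p C) (fmap p f) -> fibE A C f;
  fttfc_induced_fib : forall (A C : E) (g : Hom A C) (J : B)
    (s : Hom (p A) J) (t : Hom J (p C)),
    fibE A C g -> fmap p g = t ∘ s -> fibB (p A) J s ->
    forall (T : FibObj p J) (c : Hom (T : E) C) (u : Hom A T),
      cartesian p c -> hcast (fo_eq T) erefl (fmap p c) = t ->
      hcast erefl (fo_eq T) (fmap p u) = s -> c ∘ u = g -> fibE A T u;
  fttfc_cart_acyclic_cof : forall (A C : E) (f : Hom A C),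
    cartesian p f -> acyclic_cof fibB (fmap p f) -> acyclic_cof fibE f }.

(* Main.v *)
Require Import Defs.
From Stdlib Require Import ProofIrrelevance IndefiniteDescription.
Local Open Scope cat_scope.

(** The constructions of a fiber are carried out in [E] and moved to the fiber by
    reindexing. A fibration of [E] is a vertical fibration followed by a cartesian
    morphism, so a vertical morphism is an acyclic cofibration of its fiber exactly
    when it is one of [E]. Pullbacks and dependent products of vertical fibrations,
    computed in [E], lie over pullbacks and dependent products of identities in [B],
    hence over isomorphisms, and are made vertical by reindexing. A square in [E]
    with two parallel cartesian sides over a pullback of [B] is a pullback; hence
    reindexing is a pullback in [E] and preserves pullbacks and dependent products,
    and it preserves acyclic cofibrations because the base morphism factors as an
    acyclic cofibration followed by a fibration. For a fibration [s : I -> J],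
    [s_* A] is the dependent product of [A -> s^* 1] along the cartesian morphism
    [s^* 1 -> 1]. Computed in [E], its universal property also covers maps into
    [s_* A] above any [J' -> J], and this gives the Beck-Chevalley condition. *)

(** * Pullbacks and isomorphisms *)

Section Pullbacks.
Context {C : Category}.

Lemma is_pullback_sym {X Y Z P : C} {q1 : Hom P X} {q2 : Hom P Y}
    {f : Hom X Z} {g : Hom Y Z} :
  is_pullback q1 q2 f g -> is_pullback q2 q1 g f.
Proof.
move=> [e u]; split=> // W a b /esym /u [w [[wa wb] Hw]].
by exists w; split=> // w' [? ?]; apply: Hw.
Qed.

Lemma is_pullback_ext {X Y Z P : C} {q1 : Hom P X} {q2 : Hom P Y}
    {f : Hom X Z} {g : Hom Y Z} {W : C} {w w' : Hom W P} :
  is_pullback q1 q2 f g -> q1 ∘ w = q1 ∘ w' -> q2 ∘ w = q2 ∘ w' -> w = w'.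
Proof.
move=> [e u] e1 e2.
have [|v [_ Hv]] := u _ (q1 ∘ w') (q2 ∘ w'); first by rewrite !compA e.
by rewrite -(Hv w) // -(Hv w').
Qed.

Lemma is_pullback_lift {X Y Z P : C} {q1 : Hom P X} {q2 : Hom P Y}
    {f : Hom X Z} {g : Hom Y Z} {W : C} (a : Hom W X) (b : Hom W Y) :
  is_pullback q1 q2 f g -> f ∘ a = g ∘ b -> exists w, q1 ∘ w = a /\ q2 ∘ w = b.
Proof. by move=> [e u] /u [w [? _]]; exists w. Qed.

Lemma is_pullback_intro {X Y Z P : C} {q1 : Hom P X} {q2 : Hom P Y}
    {f : Hom X Z} {g : Hom Y Z} :
  f ∘ q1 = g ∘ q2 ->
  (forall W (a : Hom W X) (b : Hom W Y), f ∘ a = g ∘ b ->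
     exists w, q1 ∘ w = a /\ q2 ∘ w = b) ->
  (forall W (w w' : Hom W P), q1 ∘ w = q1 ∘ w' -> q2 ∘ w = q2 ∘ w' -> w = w') ->
  is_pullback q1 q2 f g.
Proof.
move=> e ex un; split=> // W a b /ex [w [wa wb]].
by exists w; split=> // w' [? ?]; apply: un; congruence.
Qed.

Lemma is_pullback_paste {X Y Z P Y' Z' : C} {q1 : Hom P X} {q2 : Hom P Y'}
    {h : Hom X Z'} {g' : Hom Y' Z'} {b : Hom Y' Y} {z : Hom Z' Z} {g : Hom Y Z} :
  is_pullback q1 q2 h g' -> is_pullback g' b z g ->
  is_pullback q1 (b ∘ q2) (z ∘ h) g.
Proof.
move=> pb pb'; apply: is_pullback_intro.
- by rewrite -compA (proj1 pb) !compA (proj1 pb').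
- move=> W u v e.
  have [|y [y1 y2]] := is_pullback_lift (h ∘ u) v pb'; first by rewrite compA.
  have [|w [w1 w2]] := is_pullback_lift u y pb; first by [].
  by exists w; rewrite -compA w2.
- move=> W w w' e1; rewrite -!compA => e2; apply: (is_pullback_ext pb) => //.
  apply: (is_pullback_ext pb') => //.
  by rewrite !compA -(proj1 pb) -!compA e1.
Qed.

Lemma is_pullback_uniq {X Y Z P P' : C} {q1 : Hom P X} {q2 : Hom P Y}
    {q1' : Hom P' X} {q2' : Hom P' Y} {f : Hom X Z} {g : Hom Y Z} :
  is_pullback q1 q2 f g -> is_pullback q1' q2' f g ->
  exists w : Hom P' P, is_iso w /\ q1 ∘ w = q1' /\ q2 ∘ w = q2'.
Proof.
move=> pb pb'.
have [w [w1 w2]] := is_pullback_lift q1' q2' pb (proj1 pb').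
have [v [v1 v2]] := is_pullback_lift q1 q2 pb' (proj1 pb).
exists w; split=> //; exists v; split.
- by apply: (is_pullback_ext pb'); rewrite compA compm1 ?v1 ?v2.
- by apply: (is_pullback_ext pb); rewrite compA compm1 ?w1 ?w2.
Qed.

Lemma is_pullback_iso {X Y Z P P' : C} {q1 : Hom P X} {q2 : Hom P Y}
    {f : Hom X Z} {g : Hom Y Z} (w : Hom P' P) :
  is_iso w -> is_pullback q1 q2 f g -> is_pullback (q1 ∘ w) (q2 ∘ w) f g.
Proof.
move=> [v [vw wv]] pb; apply: is_pullback_intro.
- by rewrite !compA (proj1 pb).
- move=> W a b /(is_pullback_lift _ _ pb) [u [u1 u2]].
  by exists (v ∘ u); rewrite -!compA (compA w) wv comp1m.
- move=> W u u'; rewrite -!compA => e1 e2.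
  by rewrite -(comp1m u) -(comp1m u') -vw -!compA (is_pullback_ext pb e1 e2).
Qed.

Lemma is_iso_id (X : C) : is_iso (idm X).
Proof. by exists (idm X); rewrite comp1m. Qed.

Lemma is_iso_monic {X Y W : C} {f : Hom X Y} {a b : Hom W X} :
  is_iso f -> f ∘ a = f ∘ b -> a = b.
Proof.
by move=> [g [gf _]] e; rewrite -(comp1m a) -(comp1m b) -gf -!compA e.
Qed.

Lemma is_pullback_id {X Z : C} (h : Hom X Z) : is_pullback h (idm X) (idm Z) h.
Proof.
apply: is_pullback_intro; first by rewrite comp1m compm1.
- by move=> W a b; rewrite comp1m => ->; exists b; rewrite comp1m.
- by move=> W w w' _; rewrite !comp1m.
Qed.

Lemma terminal_iso {T T' : C} (f : Hom T T') :
  is_terminal T -> is_terminal T' -> is_iso f.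
Proof.
move=> hT hT'; have [g _] := hT T'; exists g.
have [i [_ ui]] := hT T; have [j [_ uj]] := hT' T'.
split.
- by rewrite -(ui (idm T)) // -(ui (g ∘ f)).
- by rewrite -(uj (idm T')) // -(uj (f ∘ g)).
Qed.

End Pullbacks.

(** * Dependent products *)

(** The universal element of [DepProd f g pi]: [Q] is a value of [g^* pi] and
    [ev] corresponds to the identity of [pi]. *)
Record dp_universal {C : Category} {A B Z D Q : C} (f : Hom A B) (g : Hom B Z) (pi : Hom D Z)
    (r1 : Hom Q D) (r2 : Hom Q B) (ev : Hom Q A) : Prop := {
  dpu_pb : is_pullback r1 r2 pi g;
  dpu_ev : f ∘ ev = r2;
  dpu_ex : forall (X P : C) (h : Hom X Z) (q1 : Hom P X) (q2 : Hom P B) (e : Hom P A),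
    is_pullback q1 q2 h g -> f ∘ e = q2 ->
    exists (k : Hom X D) (w : Hom P Q),
      pi ∘ k = h /\ r1 ∘ w = k ∘ q1 /\ r2 ∘ w = q2 /\ ev ∘ w = e;
  dpu_uniq : forall (X P : C) (h : Hom X Z) (q1 : Hom P X) (q2 : Hom P B)
      (k k' : Hom X D) (w w' : Hom P Q),
    is_pullback q1 q2 h g -> pi ∘ k = h -> pi ∘ k' = h ->
    r1 ∘ w = k ∘ q1 -> r1 ∘ w' = k' ∘ q1 -> r2 ∘ w = q2 -> r2 ∘ w' = q2 ->
    ev ∘ w = ev ∘ w' -> k = k' }.

Arguments dpu_pb {C A B Z D Q f g pi r1 r2 ev} _.
Arguments dpu_ev {C A B Z D Q f g pi r1 r2 ev} _.
Arguments dpu_ex {C A B Z D Q f g pi r1 r2 ev} _ {X P h q1 q2 e} _ _.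
Arguments dpu_uniq {C A B Z D Q f g pi r1 r2 ev} _ {X P h q1 q2 k k' w w'} _ _ _ _ _ _ _ _.

Section DependentProducts.
Context {C : Category}.

Lemma slice_hom_eq {Z X Y : C} {h : Hom X Z} {k : Hom Y Z} (a b : slice_hom h k) :
  sval a = sval b -> a = b.
Proof.
case: a b => [a pa] [b pb] /= e; subst b.
by rewrite (proof_irrelevance _ pa pb).
Qed.

(** By the Yoneda lemma: [k] is a slice morphism from [h] to [pi], and naturality along it writes
    the transpose of [k] as [ev], the transpose of the identity, composed with the base change [w]
    of [k]. *)
Lemma DepProd_universal {A B Z D Q : C} {f : Hom A B} {g : Hom B Z} {pi : Hom D Z}
    {r1 : Hom Q D} {r2 : Hom Q B} (d : DepProd f g pi) (pbQ : is_pullback r1 r2 pi g) :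
  let ev := sval (dp_bij d pbQ (exist _ (idm D) (compm1 pi))) in
  dp_universal f g pi r1 r2 ev /\
  forall (X P : C) (h : Hom X Z) (q1 : Hom P X) (q2 : Hom P B)
    (pb : is_pullback q1 q2 h g) (k : slice_hom h pi) (w : Hom P Q),
    r1 ∘ w = sval k ∘ q1 -> r2 ∘ w = q2 -> sval (dp_bij d pb k) = ev ∘ w.
Proof.
set idD := exist _ _ _; move=> ev.
have nat (X P : C) (h : Hom X Z) (q1 : Hom P X) (q2 : Hom P B)
    (pb : is_pullback q1 q2 h g) (k : slice_hom h pi) (w : Hom P Q) :
    r1 ∘ w = sval k ∘ q1 -> r2 ∘ w = q2 -> sval (dp_bij d pb k) = ev ∘ w.
  move=> e1 e2; apply: (dp_natural (m := sval k) d pbQ pb (k := idD)) => //=.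
    exact: (svalP k).
  by rewrite comp1m.
split=> //; split=> //.
- exact: (svalP (dp_bij d pbQ idD)).
- move=> X P h q1 q2 e pb fe.
  have [inv _ can] := dp_bijective d pb.
  have Hk := can (exist _ e fe); set k := inv _ in Hk.
  have [|w [w1 w2]] := is_pullback_lift (sval k ∘ q1) q2 pbQ.
    by rewrite compA (svalP k) (proj1 pb).
  exists (sval k), w; split; first exact: (svalP k).
  by rewrite -(nat _ _ _ _ _ pb k) // Hk.
- move=> X P h q1 q2 k k' w w' pb pk pk' e1 e1' e2 e2' ee.
  have [inv can _] := dp_bijective d pb.
  suff E : exist _ k pk = exist (fun m => pi ∘ m = h) k' pk'.
    by have := congr1 sval E.
  rewrite -[LHS]can -[RHS]can; congr inv; apply: slice_hom_eq.
  by rewrite (nat _ _ _ _ _ pb _ w) // (nat _ _ _ _ _ pb _ w').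
Qed.

(** The converse direction: [k] is sent to [ev ∘ w], where [w] is a chosen base change of [k]. The
    final equation pins the bijection down, which is what canonical preservation of dependent
    products requires. *)
Lemma universal_DepProd {A B Z D Q : C} {f : Hom A B} {g : Hom B Z} {pi : Hom D Z}
    {r1 : Hom Q D} {r2 : Hom Q B} {ev : Hom Q A} :
  dp_universal f g pi r1 r2 ev ->
  exists d : DepProd f g pi,
    forall (X P : C) (h : Hom X Z) (q1 : Hom P X) (q2 : Hom P B)
      (pb : is_pullback q1 q2 h g) (k : slice_hom h pi) (w : Hom P Q),
      r1 ∘ w = sval k ∘ q1 -> r2 ∘ w = q2 -> sval (dp_bij d pb k) = ev ∘ w.
Proof.
move=> u; have pbQ := dpu_pb u.
have lift (X P : C) (h : Hom X Z) (q1 : Hom P X) (q2 : Hom P B)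
    (pb : is_pullback q1 q2 h g) (k : slice_hom h pi) :
    {w : Hom P Q | r1 ∘ w = sval k ∘ q1 /\ r2 ∘ w = q2}.
  apply: constructive_indefinite_description.
  by apply: (is_pullback_lift _ _ pbQ); rewrite compA (svalP k) (proj1 pb).
have ok (X P : C) (h : Hom X Z) (q1 : Hom P X) (q2 : Hom P B)
    (pb : is_pullback q1 q2 h g) (k : slice_hom h pi) :
    f ∘ (ev ∘ sval (lift X P h q1 q2 pb k)) = q2.
  by rewrite compA (dpu_ev u); case: (svalP (lift X P h q1 q2 pb k)).
pose bij (X P : C) (h : Hom X Z) (q1 : Hom P X) (q2 : Hom P B)
    (pb : is_pullback q1 q2 h g) (k : slice_hom h pi) : slice_hom q2 f :=
  exist _ _ (ok X P h q1 q2 pb k).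
have bijE (X P : C) (h : Hom X Z) (q1 : Hom P X) (q2 : Hom P B)
    (pb : is_pullback q1 q2 h g) (k : slice_hom h pi) (w : Hom P Q) :
    r1 ∘ w = sval k ∘ q1 -> r2 ∘ w = q2 -> sval (bij X P h q1 q2 pb k) = ev ∘ w.
  move=> e1 e2 /=; case: (lift _ _ _ _ _ _ _) => v [v1 v2] /=; congr (ev ∘ _).
  by apply: (is_pullback_ext pbQ); congruence.
unshelve eexists {| dp_bij := bij |}; last exact: bijE.
- move=> X P h q1 q2 pb.
  have sur (e : slice_hom q2 f) : {k : slice_hom h pi | bij _ _ _ _ _ pb k = e}.
    apply: constructive_indefinite_description.
    have [k [w [pk [w1 [w2 ew]]]]] := dpu_ex u pb (svalP e).
    exists (exist _ k pk); apply: slice_hom_eq.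
    by rewrite (bijE _ _ _ _ _ pb _ w).
  have inj k k' : bij _ _ _ _ _ pb k = bij _ _ _ _ _ pb k' -> k = k'.
    move=> /(congr1 sval) /= e; apply: slice_hom_eq.
    have [w1 w2] := svalP (lift _ _ _ _ _ pb k).
    have [w1' w2'] := svalP (lift _ _ _ _ _ pb k').
    exact: (dpu_uniq u pb (svalP k) (svalP k') w1 w1' w2 w2' e).
  exists (fun e => sval (sur e)).
  + by move=> k; apply: inj; apply: (svalP (sur _)).
  + by move=> e; apply: (svalP (sur _)).
- move=> X X' P P' h h' q1 q2 q1' q2' pb pb' m w k k' em e1 e2 ek.
  have [v1 v2] := svalP (lift _ _ _ _ _ pb k).
  rewrite (bijE _ _ _ _ _ pb' k' (sval (lift _ _ _ _ _ pb k) ∘ w)) /=.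
  + by rewrite compA v1 ek -!compA e1.
  + by rewrite compA v2.
  + by rewrite compA.
Qed.

(** Only [a] is inverted: maps into [Q'] come from the pullback [pb'], and [b] carries them to the
    corresponding maps into [Q]. *)
Lemma dp_universal_iso {A B Z D Q D' Q' : C} {f : Hom A B} {g : Hom B Z}
    {pi : Hom D Z} {r1 : Hom Q D} {r2 : Hom Q B} {ev : Hom Q A}
    {pi' : Hom D' Z} {r1' : Hom Q' D'} {r2' : Hom Q' B} {ev' : Hom Q' A}
    (a : Hom D' D) (b : Hom Q' Q) :
  is_iso a -> pi ∘ a = pi' -> r1 ∘ b = a ∘ r1' -> r2 ∘ b = r2' -> ev ∘ b = ev' ->
  is_pullback r1' r2' pi' g ->
  dp_universal f g pi r1 r2 ev -> dp_universal f g pi' r1' r2' ev'.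
Proof.
move=> ia epi er1 er2 eev pb' u; split=> //.
- by rewrite -eev compA (dpu_ev u).
- move=> X P h q1 q2 e pb fe.
  have [k [w [pk [w1 [w2 ew]]]]] := dpu_ex u pb fe.
  have [a' [a'a aa']] := ia.
  have [|v [v1 v2]] := is_pullback_lift (a' ∘ k ∘ q1) q2 pb'.
    by rewrite -epi -!compA (compA a) aa' comp1m compA pk (proj1 pb).
  exists (a' ∘ k), v; split; last split=> //; last split=> //.
    by rewrite -epi -!compA (compA a) aa' comp1m.
  rewrite -eev -compA (_ : b ∘ v = w) //.
  apply: (is_pullback_ext (dpu_pb u)); last by rewrite compA er2 v2.
  by rewrite compA er1 -compA v1 !compA aa' comp1m.
- move=> X P h q1 q2 k k' w w' pb pk pk' e1 e1' e2 e2' ee.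
  apply: (is_iso_monic ia).
  apply: (dpu_uniq u (w := b ∘ w) (w' := b ∘ w') pb).
  + by rewrite compA epi.
  + by rewrite compA epi.
  + by rewrite compA er1 -!compA e1.
  + by rewrite compA er1 -!compA e1'.
  + by rewrite compA er2.
  + by rewrite compA er2.
  + by rewrite !compA eev.
Qed.

Lemma dp_universal_uniq {A B Z D Q D' Q' : C} {f : Hom A B} {g : Hom B Z}
    {pi : Hom D Z} {r1 : Hom Q D} {r2 : Hom Q B} {ev : Hom Q A}
    {pi' : Hom D' Z} {r1' : Hom Q' D'} {r2' : Hom Q' B} {ev' : Hom Q' A} :
  dp_universal f g pi r1 r2 ev -> dp_universal f g pi' r1' r2' ev' ->
  exists (a : Hom D' D) (b : Hom Q' Q), is_iso a /\
    pi ∘ a = pi' /\ r1 ∘ b = a ∘ r1' /\ r2 ∘ b = r2' /\ ev ∘ b = ev'.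
Proof.
move=> u u'.
have [a [b [pa [a1 [a2 ea]]]]] := dpu_ex u (dpu_pb u') (dpu_ev u').
have [a' [b' [pa' [a1' [a2' ea']]]]] := dpu_ex u' (dpu_pb u) (dpu_ev u).
exists a, b; split=> //; exists a'; split.
- apply: (dpu_uniq u' (w := b' ∘ b) (w' := idm Q') (dpu_pb u')).
  + by rewrite compA pa' pa.
  + by rewrite compm1.
  + by rewrite compA a1' -!compA a1.
  + by rewrite comp1m compm1.
  + by rewrite compA a2' a2.
  + by rewrite compm1.
  + by rewrite compA ea' ea compm1.
- apply: (dpu_uniq u (w := b ∘ b') (w' := idm Q) (dpu_pb u)).
  + by rewrite compA pa pa'.
  + by rewrite compm1.
  + by rewrite compA a1 -!compA a1'.
  + by rewrite comp1m compm1.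
  + by rewrite compA a2 a2'.
  + by rewrite compm1.
  + by rewrite compA ea ea' compm1.
Qed.

(** The inverse of [f] is a section over the identity of [B], which is the base change of the
    identity of [Z]; it transposes to a section [k] of [pi]. The other composite [k ∘ pi] is the
    identity because morphisms over [B] into the isomorphism [f] are unique. *)
Lemma DepProd_of_iso {A B Z D Q : C} {f : Hom A B} {g : Hom B Z} {pi : Hom D Z}
    {r1 : Hom Q D} {r2 : Hom Q B} :
  is_iso f -> is_pullback r1 r2 pi g -> DepProd f g pi -> is_iso pi.
Proof.
move=> iso_f pbQ d; have [u _] := DepProd_universal d pbQ.
have [f' [f'f ff']] := iso_f.
have [|k [w [pk _]]] := dpu_ex u (e := f') (is_pullback_id g).
  by [].
exists k; split=> //.
have [|w' [w1 w2]] := is_pullback_lift (k ∘ pi ∘ r1) r2 pbQ.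
  by rewrite 2!compA pk comp1m (proj1 pbQ).
apply: (dpu_uniq u (w := w') (w' := idm Q) pbQ) => //.
- by rewrite compA pk comp1m.
- by rewrite compm1.
- by rewrite compm1 comp1m.
- by rewrite compm1.
- by apply: (is_iso_monic iso_f); rewrite !compA (dpu_ev u) compm1.
Qed.

End DependentProducts.

(** * Acyclic cofibrations *)

Section FibrationCategories.
Context {C : Category} {fib : MorClass C} (hC : is_ttfc fib).

Lemma acyclic_cof_comp {X Y Z : C} {g : Hom Y Z} {f : Hom X Y} :
  acyclic_cof fib g -> acyclic_cof fib f -> acyclic_cof fib (g ∘ f).
Proof.
move=> ag af U V q hq a b e.
have [|h1 [h1f qh1]] := af _ _ q hq a (b ∘ g); first by rewrite e compA.
have [h2 [h2g qh2]] := ag _ _ q hq h1 b qh1.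
by exists h2; rewrite compA h2g.
Qed.

(** Since [V -> 1] is a fibration, [b] extends along [g] to [b'] on [Z]. A lift for [g ∘ f] against
    [b'], precomposed with [g], solves the problem for [f]. *)
Lemma acyclic_cof_cancel {X Y Z : C} {g : Hom Y Z} {f : Hom X Y} :
  acyclic_cof fib g -> acyclic_cof fib (g ∘ f) -> acyclic_cof fib f.
Proof.
move=> ag agf U V q hq a b e.
have [T hT] := ttfc_terminal hC.
have [tV _] := hT V; have [tZ _] := hT Z.
have [|b' [b'g _]] := ag _ _ tV (ttfc_fib_terminal hC tV hT) b tZ.
  by have [t [_ ut]] := hT Y; rewrite -(ut (tV ∘ b)) // -(ut (tZ ∘ g)).
have [|h [hgf qh]] := agf _ _ q hq a b'; first by rewrite compA b'g.
by exists (h ∘ g); rewrite -compA hgf compA qh.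
Qed.

(* A lifting problem for [q2] is transposed to one for [i] against a dependent
   product along [g]. *)
Lemma acyclic_cof_pullback {A B Z P : C} {q1 : Hom P A} {q2 : Hom P B}
    {i : Hom A Z} {g : Hom B Z} :
  is_pullback q1 q2 i g -> fib B Z g -> acyclic_cof fib i -> acyclic_cof fib q2.
Proof.
move=> pb hg ai U V q hq a b e.
(* After pulling [q] back along [b], a lift amounts to a section of [y] that restricts to [a'] along
   [q2]. Sections of [y] correspond to sections of [pi], and [a'] corresponds to [k]. *)
have [R [x [y pbR]]] := ttfc_pullback hC b hq.
have hy := ttfc_pullback_fib hC pbR hq.
have [D [pi [hpi [d]]]] := ttfc_dep_prod hC hy hg.
have [Q [r1 [r2 pbQ]]] := ttfc_pullback hC g hpi.
have [u _] := DepProd_universal d pbQ.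
set ev := sval _ in u.
have [a' [xa' ya']] := is_pullback_lift _ _ pbR e.
have [k [w [pk [w1 [w2 ew]]]]] := dpu_ex u pb ya'.
have [|l [li pl]] := ai _ _ pi hpi k (idm Z); first by rewrite comp1m.
have [|v [v1 v2]] := is_pullback_lift (l ∘ g) (idm B) pbQ.
  by rewrite compA pl comp1m compm1.
exists (x ∘ (ev ∘ v)); split.
- rewrite -!compA (_ : v ∘ q2 = w); last by rewrite ew.
  apply: (is_pullback_ext pbQ).
  + by rewrite compA v1 -compA -(proj1 pb) compA li w1.
  + by rewrite compA v2 comp1m w2.
- by rewrite compA (proj1 pbR) -compA (compA y) (dpu_ev u) v2 compm1.
Qed.

Lemma fib_comp_iso {X Y Z : C} {g : Hom Y Z} {f : Hom X Y} :
  fib Y Z g -> is_iso f -> fib X Z (g ∘ f).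
Proof. by move=> hg hf; apply: (ttfc_fib_comp hC) => //; apply: (ttfc_fib_iso hC). Qed.

End FibrationCategories.

(** * Adjunctions *)

Section Adjunctions.
Context {C D : Category} {F : Functor C D}.

(** [ev] is a universal arrow from [F] to [A], the property of a counit component. *)
Definition couniversal {A : D} {X : C} (ev : Hom (F X) A) : Prop :=
  forall (Y : C) (e : Hom (F Y) A), exists! k : Hom Y X, ev ∘ fmap F k = e.

Lemma couniversal_uniq {A : D} {X Y : C} {ev : Hom (F X) A} {k k' : Hom Y X} :
  couniversal ev -> ev ∘ fmap F k = ev ∘ fmap F k' -> k = k'.
Proof.
move=> u e; have [l [_ ul]] := u Y (ev ∘ fmap F k').
by rewrite -(ul k) // -(ul k').
Qed.

Lemma right_adjoint_ex :
  (forall A : D, exists (X : C) (ev : Hom (F X) A), couniversal ev) ->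
  exists G : Functor D C, inhabited (Adjunction F G).
Proof.
move=> ex.
have c A : {X : C & {ev : Hom (F X) A | couniversal ev}}.
  have [X HX] := constructive_indefinite_description _ (ex A).
  by exists X; apply: constructive_indefinite_description.
pose R A := projT1 (c A); pose ev A : Hom (F (R A)) A := sval (projT2 (c A)).
have uev A : couniversal (ev A) := svalP (projT2 (c A)).
have tr Y A (e : Hom (F Y) A) : {k : Hom Y (R A) | ev A ∘ fmap F k = e}.
  apply: constructive_indefinite_description.
  by have [k [Hk _]] := uev A Y e; exists k.
pose m A A' (f : Hom A A') := sval (tr (R A) A' (f ∘ ev A)).
have mE A A' (f : Hom A A') : ev A' ∘ fmap F (m A A' f) = f ∘ ev A.
  exact: (svalP (tr _ _ _)).
unshelve epose (G := {| fobj := R; fmap := m |}).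
- move=> A; apply: (couniversal_uniq (uev A)).
  by rewrite mE fmap1 comp1m compm1.
- move=> X Y Z g f; apply: (couniversal_uniq (uev Z)).
  by rewrite mE fmapM compA mE -(compA g (ev Y)) mE compA.
- exists G; split.
  pose eta X := sval (tr X (F X) (idm _)).
  have etaE X : ev (F X) ∘ fmap F (eta X) = idm _ by exact: (svalP (tr _ _ _)).
  unshelve refine (@Build_Adjunction C D F G
    (@Build_NatTrans _ _ (id_functor C) (comp_functor G F) eta _)
    (@Build_NatTrans _ _ (comp_functor F G) (id_functor D) ev _) _ _).
  + move=> X Y f; apply: (couniversal_uniq (uev (F Y))) => /=.
    by rewrite !fmapM !compA etaE mE -compA etaE comp1m compm1.
  + by move=> X Y f; apply: mE.
  + exact: etaE.
  + move=> X /=; apply: (couniversal_uniq (uev X)).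
    by rewrite fmapM compA mE -compA etaE fmap1.
Qed.

Context {G : Functor D C} (adj : Adjunction F G).

Lemma adj_transposeK {X : C} {A : D} (e : Hom (F X) A) :
  adj_counit adj A ∘ fmap F (fmap G e ∘ adj_unit adj X) = e.
Proof.
have /= nat := nt_natural (adj_counit adj) e.
by rewrite fmapM compA nat -compA (adj_triangle_l adj) compm1.
Qed.

Lemma counit_couniversal (A : D) : couniversal (adj_counit adj A).
Proof.
move=> Y e; exists (fmap G e ∘ adj_unit adj Y); split; first exact: adj_transposeK.
move=> k <-; have /= nat := nt_natural (adj_unit adj) k.
by rewrite fmapM -compA -nat compA (adj_triangle_r adj) comp1m.
Qed.

(** The transpose of [ev] is the comparison between two universal arrows to [A], namely [ev] and the
    counit. *)
Lemma couniversal_transpose_iso {X : C} {A : D} {ev : Hom (F X) A} :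
  couniversal ev -> is_iso (fmap G ev ∘ adj_unit adj X).
Proof.
move=> u; set t := _ ∘ _.
have tE : adj_counit adj A ∘ fmap F t = ev by apply: adj_transposeK.
have [v [vE _]] := u (G A) (adj_counit adj A).
exists v; split.
- by apply: (couniversal_uniq u); rewrite fmapM compA vE tE fmap1 compm1.
- apply: (couniversal_uniq (counit_couniversal A)).
  by rewrite fmapM compA tE vE fmap1 compm1.
Qed.

End Adjunctions.

(** * Cartesian morphisms *)

Section Cartesian.
Context {E B : Category} {p : Functor E B}.

Definition base {I J : B} {A : FibObj p I} {A' : FibObj p J} (f : Hom A A') : Hom I J :=
  hcast (fo_eq A) (fo_eq A') (fmap p f).

Lemma above_base {I J : B} {A : FibObj p I} {A' : FibObj p J} (f : Hom A A') :
  above f (base f).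
Proof. by []. Qed.

Lemma above_ex {I J : B} {A : FibObj p I} {A' : FibObj p J} (f : Hom A A') :
  exists s : Hom I J, above f s.
Proof. by exists (base f). Qed.

Lemma above_cancel {I J : B} {X : FibObj p I} {Y Z : FibObj p J} {g : Hom Y Z}
    {f : Hom X Y} {s : Hom I J} :
  above g (idm J) -> above (g ∘ f) s -> above f s.
Proof.
move=> ag agf; have := above_vcompl ag (above_base f).
by rewrite /above in agf *; rewrite agf => ->.
Qed.

Lemma cartesian_ex {I J K : B} {A : FibObj p I} {A' : FibObj p J} {X : FibObj p K}
    {f : Hom A A'} {s : Hom I J} {g : Hom X A'} (r : Hom K I) :
  cartesian p f -> above f s -> above g (s ∘ r) ->
  exists h : Hom X A, f ∘ h = g /\ above h r.
Proof. by move=> cf af ag; have [h [? _]] := cartesian_above cf af ag; exists h. Qed.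

Lemma cartesian_uniq {I J K : B} {A : FibObj p I} {A' : FibObj p J} {X : FibObj p K}
    {f : Hom A A'} {r : Hom K I} {h h' : Hom X A} :
  cartesian p f -> above h r -> above h' r -> f ∘ h = f ∘ h' -> h = h'.
Proof.
move=> cf ah ah' e.
have [k [_ Hk]] := cartesian_above cf (above_base f) (above_comp (above_base f) ah).
by rewrite -(Hk h) // -(Hk h').
Qed.

Lemma cartesian_intro {I J : B} {A : FibObj p I} {A' : FibObj p J}
    {f : Hom A A'} {s : Hom I J} :
  above f s ->
  (forall K (X : FibObj p K) (g : Hom X A') (r : Hom K I), above g (s ∘ r) ->
     exists h : Hom X A, f ∘ h = g /\ above h r) ->
  (forall K (X : FibObj p K) (h h' : Hom X A) (r : Hom K I), above h r -> above h' r ->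
     f ∘ h = f ∘ h' -> h = h') ->
  cartesian p f.
Proof.
case: A f => A eA; case: A' => A' eA'; destruct eA, eA' => f; rewrite {1}/above /= => <-.
move=> ex un X g r e.
(* An object [X] of [E] is viewed as lying above [p X] through reflexivity, so that statements about
   [above] apply to it. *)
have [h [fh ah]] := ex (p X) (Build_FibObj (p := p) (fo_obj := X) erefl) g r (esym e).
exists h; split=> // h' [fh' ah'].
apply: (un (p X) (Build_FibObj (p := p) (fo_obj := X) erefl) h h' r) => //.
by rewrite fh fh'.
Qed.

Lemma cartesian_cancel {I J K : B} {A : FibObj p I} {A' : FibObj p J} {A'' : FibObj p K}
    {c : Hom A' A''} {d : Hom A A'} {s : Hom J K} {r : Hom I J} :
  cartesian p c -> above c s -> cartesian p (c ∘ d) -> above d r -> cartesian p d.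
Proof.
move=> cc ac ccd ad; apply: (cartesian_intro ad).
- move=> L X g q ag.
  have [|h [e ah]] := cartesian_ex (g := c ∘ g) q ccd (above_comp ac ad).
    by rewrite -compA; apply: above_comp ac ag.
  exists h; split=> //; apply: (cartesian_uniq cc (above_comp ad ah) ag).
  by rewrite compA.
- move=> L X h h' q ah ah' e; apply: (cartesian_uniq ccd ah ah').
  by rewrite -!compA e.
Qed.

Lemma cartesian_iso {I J : B} {A : FibObj p I} {A' : FibObj p J} {f : Hom A A'}
    {s : Hom I J} : cartesian p f -> above f s -> is_iso s -> is_iso f.
Proof.
move=> cf af [r [rs sr]].
have [|g [fg ag]] := cartesian_ex (g := idm (A' : E)) r cf af.
  by rewrite sr; apply: above_id.
exists g; split=> //.
have agf : above (g ∘ f) (idm I) by rewrite -rs; apply: above_comp.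
apply: (cartesian_uniq cf agf (above_id A)).
by rewrite compA fg comp1m compm1.
Qed.

(** The mediating map on bases comes from [pb]; it lifts to [h] because [d] is cartesian, and [h] is
    compatible with [b] because [c] is cartesian. *)
Lemma is_pullback_cartesian {I J I' J' : B} {A : FibObj p I} {A' : FibObj p J}
    {X' : FibObj p I'} {X : FibObj p J'} {c : Hom A A'} {d : Hom X' X}
    {x : Hom X A'} {x' : Hom X' A} {s : Hom I J} {r : Hom J' J} {t : Hom I' I}
    {s' : Hom I' J'} :
  cartesian p c -> above c s -> cartesian p d -> above d s' -> above x r ->
  above x' t -> x ∘ d = c ∘ x' -> is_pullback s' t r s -> is_pullback d x' x c.
Proof.
move=> cc ac cd ad ax ax' e pb; apply: is_pullback_intro => //.
- move=> W a b eab; pose W' := Build_FibObj (p := p) (fo_obj := W) erefl.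
  have aa : above (A := W') (A' := X) a (base (A := W') (A' := X) a) by [].
  have ab : above (A := W') (A' := A) b (base (A := W') (A' := A) b) by [].
  have eb : r ∘ base (A := W') (A' := X) a = s ∘ base (A := W') (A' := A) b.
    by rewrite -(above_comp ax aa) -(above_comp ac ab) eab.
  have [w [w1 w2]] := is_pullback_lift _ _ pb eb.
  have [|h [h1 ah]] := cartesian_ex (X := W') (g := a) w cd ad; first by rewrite w1.
  exists h; split=> //; apply: (cartesian_uniq (X := W') cc _ ab).
  + by rewrite -w2; apply: above_comp ax' ah.
  + by rewrite compA -e -compA h1 eab.
- move=> W w w' e1 e2; pose W' := Build_FibObj (p := p) (fo_obj := W) erefl.
  have aw : above (A := W') (A' := X') w (base (A := W') (A' := X') w) by [].
  have aw' : above (A := W') (A' := X') w' (base (A := W') (A' := X') w') by [].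
  apply: (cartesian_uniq (X := W') cd aw _ e1); rewrite /above.
  rewrite aw'; apply: (is_pullback_ext pb).
  + by rewrite -(above_comp ad aw) -(above_comp ad aw') e1.
  + by rewrite -(above_comp ax' aw) -(above_comp ax' aw') e2.
Qed.

End Cartesian.

(** * Fibers *)

Section FibredFibrationCategories.
Context {E B : Category} {fibE : MorClass E} {fibB : MorClass B} {p : Functor E B}.
Context (hp : is_fibred_ttfc fibE fibB p).

Let hE : is_ttfc fibE := ttf_dom (fttfc_tt_functor hp).
Let hB : is_ttfc fibB := ttf_cod (fttfc_tt_functor hp).

(** * The axioms of [p] for objects above given base objects *)

Lemma fib_base {I J : B} {A : FibObj p I} {A' : FibObj p J} {f : Hom A A'} {s : Hom I J} :
  fibE A A' f -> above f s -> fibB I J s.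
Proof.
case: A f => A eA; case: A' => A' eA'; destruct eA, eA' => /= f hf <-.
exact: (ttf_fib (fttfc_tt_functor hp)).
Qed.

Lemma acyclic_cof_base {I J : B} {A : FibObj p I} {A' : FibObj p J} {f : Hom A A'}
    {s : Hom I J} : acyclic_cof fibE f -> above f s -> acyclic_cof fibB s.
Proof.
case: A f => A eA; case: A' => A' eA'; destruct eA, eA' => /= f hf <-.
exact: (ttf_acyclic_cof (fttfc_tt_functor hp)).
Qed.

Lemma is_pullback_base {I J K L : B} {P : FibObj p I} {X : FibObj p J} {Y : FibObj p K}
    {Z : FibObj p L} {q1 : Hom P X} {q2 : Hom P Y} {f : Hom X Z} {g : Hom Y Z}
    {s1 : Hom I J} {s2 : Hom I K} {t1 : Hom J L} {t2 : Hom K L} :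
  fibE X Z f -> is_pullback q1 q2 f g -> above q1 s1 -> above q2 s2 -> above f t1 ->
  above g t2 -> is_pullback s1 s2 t1 t2.
Proof.
case: P q1 q2 => P eP; case: X f => X eX; case: Y g => Y eY; case: Z => Z eZ.
destruct eP, eX, eY, eZ => /= f g q1 q2 hf pb <- <- <- <-.
exact: (ttf_pullback (fttfc_tt_functor hp)).
Qed.

Lemma DepProd_base {I J K L : B} {A : FibObj p I} {A' : FibObj p J} {Z : FibObj p K}
    {D : FibObj p L} {f : Hom A A'} {g : Hom A' Z} {pi : Hom D Z}
    {s : Hom I J} {t : Hom J K} {d : Hom L K} :
  fibE A A' f -> fibE A' Z g -> fibE D Z pi -> DepProd f g pi ->
  above f s -> above g t -> above pi d -> inhabited (DepProd s t d).
Proof.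
case: A f => A eA; case: A' g => A' eA'; case: Z pi => Z eZ; case: D => D eD.
destruct eA, eA', eZ, eD => /= pi g f hf hg hpi dp <- <- <-.
by have [d' _] := ttf_dep_prod (fttfc_tt_functor hp) hf hg hpi dp.
Qed.

Lemma cartesian_fib {I J : B} {A : FibObj p I} {A' : FibObj p J} {f : Hom A A'}
    {s : Hom I J} : cartesian p f -> above f s -> fibB I J s -> fibE A A' f.
Proof.
case: A f => A eA; case: A' => A' eA'; destruct eA, eA' => /= f cf <-.
exact: (fttfc_cart_fib hp).
Qed.

Lemma cartesian_acyclic_cof {I J : B} {A : FibObj p I} {A' : FibObj p J} {f : Hom A A'}
    {s : Hom I J} :
  cartesian p f -> above f s -> acyclic_cof fibB s -> acyclic_cof fibE f.
Proof.
case: A f => A eA; case: A' => A' eA'; destruct eA, eA' => /= f cf <-.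
exact: (fttfc_cart_acyclic_cof hp).
Qed.

Lemma induced_fib {I J K : B} {A : FibObj p I} {C : FibObj p K} {T : FibObj p J}
    {g : Hom A C} {c : Hom T C} {u : Hom A T} {s : Hom I J} {t : Hom J K} :
  fibE A C g -> cartesian p c -> above c t -> above u s -> fibB I J s -> c ∘ u = g ->
  fibE A T u.
Proof.
move=> hg cc ac au hs e; have ag : above g (t ∘ s) by rewrite -e; apply: above_comp.
case: A u g hg au ag e => A eA; case: C c cc ac => C eC; destruct eA, eC.
move=> c cc ac u g hg au ag e; exact: (fttfc_induced_fib hp hg ag hs cc ac au e).
Qed.

Lemma cartesian_lift {I J : B} (s : Hom I J) (A : FibObj p J) :
  exists (A' : FibObj p I) (f : Hom A' A), cartesian p f /\ above f s.
Proof. exact: (fttfc_fibration hp). Qed.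

(** A cartesian lift of an isomorphism is an isomorphism. Hence an object built in [E] above a base
    object isomorphic to [I] can be moved into the fiber over [I], unchanged up to isomorphism. *)
Lemma vertical_replacement {I K : B} (D : FibObj p K) {v : Hom I K} :
  is_iso v -> exists (D' : FibObj p I) (a : Hom D' D), is_iso a /\ above a v.
Proof.
move=> iv; have [D' [a [ca aa]]] := cartesian_lift v D.
by exists D', a; split=> //; apply: cartesian_iso iv.
Qed.

(** * Terminal objects of fibers *)

(** Terminality that is stable under reindexing: there is exactly one morphism above each [r], not
    only above the identity. *)
Definition fiberwise_terminal {I : B} (T : FibObj p I) : Prop :=
  (forall K (X : FibObj p K) (r : Hom K I), exists h : Hom X T, above h r) /\
  (forall K (X : FibObj p K) (r : Hom K I) (h h' : Hom X T),
     above h r -> above h' r -> h = h').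

(* The reindexing of the terminal object of [E] along [I -> 1]. *)
Lemma fiberwise_terminal_ex (I : B) : exists T : FibObj p I, fiberwise_terminal T /\
  forall (X : FibObj p I) (f : Hom X T), above f (idm I) -> fibE X T f.
Proof.
have [T1 hT1] := ttfc_terminal hE.
pose T1' := Build_FibObj (p := p) (fo_obj := T1) erefl.
have hpT : is_terminal (p T1) := ttf_terminal (fttfc_tt_functor hp) hT1.
have uB K (a b : Hom K (p T1)) : a = b.
  by have [t [_ ut]] := hpT K; rewrite -(ut a) // -(ut b).
have uE K (a b : Hom K T1) : a = b.
  by have [t [_ ut]] := hT1 K; rewrite -(ut a) // -(ut b).
have [t _] := hpT I; have [T [c [cc ac]]] := cartesian_lift t T1'.
exists T; split; first split.
- move=> K X r; have [g _] := hT1 X.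
  have [|h [_ ah]] := cartesian_ex (A' := T1') (X := X) (g := g) r cc ac; last by exists h.
  exact: uB.
- by move=> K X r h h' ah ah'; apply: (cartesian_uniq cc ah ah'); apply: uE.
- move=> X f af; have [g _] := hT1 X.
  (* The fibration [X -> 1] of [E] induces [f] into the reindexed terminal object, above the
     identity of [I]. *)
  apply: (induced_fib (C := T1') (g := g) _ cc ac af); last exact: uE.
  + exact: (ttfc_fib_terminal hE g hT1).
  + by apply: (ttfc_fib_iso hB); apply: is_iso_id.
Qed.

Lemma fiber_is_iso {I : B} {X Y : fiber p I} {f : Hom X Y} :
  is_iso f <-> is_iso (C := E) (sval f).
Proof.
split=> [[g [gf fg]]|[g [gf fg]]].
- by exists (sval g); split; [exact: (congr1 sval gf) | exact: (congr1 sval fg)].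
- have ag : above (A := Y) (A' := X) g (idm I).
    by apply: (above_cancel (svalP f)); rewrite fg; apply: above_id.
  by exists (exist _ g ag); split; apply: FibHom_eq.
Qed.

Lemma fiberwise_terminal_fiber {I : B} {T : FibObj p I} :
  fiberwise_terminal T -> is_terminal (C := fiber p I) T.
Proof.
move=> [ex un] X; have [h ah] := ex I X (idm I).
exists (exist _ h ah); split=> // k _; apply: FibHom_eq.
exact: (un _ _ _ _ _ ah (svalP k)).
Qed.

(** Both properties are invariant under vertical isomorphism, and [T] is isomorphic in its fiber to
    the terminal object built from that of [E]. *)
Lemma fiber_terminalP {I : B} {T : fiber p I} :
  is_terminal T -> fiberwise_terminal T /\
  forall (X : FibObj p I) (f : Hom X (T : FibObj p I)),
    above f (idm I) -> fibE X (T : FibObj p I) f.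
Proof.
move=> hT; have [T' [[ex un] fT']] := fiberwise_terminal_ex I.
have [a [_ _]] := hT T'; have [b [_ _]] := fiberwise_terminal_fiber (conj ex un) T.
have [a' [a'a aa']] : is_iso (C := E) (sval a).
  apply/(fiber_is_iso (f := a)); apply: terminal_iso hT.
  exact: fiberwise_terminal_fiber.
have ia : is_iso (C := E) (sval a) by exists a'.
have aa : above a' (idm I).
  by apply: (above_cancel (svalP a)); rewrite aa'; apply: above_id.
split; first split.
- move=> K X r; have [h ah] := ex K X r.
  by exists (sval a ∘ h); apply: above_vcompl (svalP a) ah.
- move=> K X r h h' ah ah'; rewrite -(comp1m h) -(comp1m h') -aa' -!compA.
  by congr (_ ∘ _); apply: (un K X r); apply: above_vcompl.
- move=> X f af; rewrite -(comp1m f) -aa' -compA.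
  apply: (ttfc_fib_comp hE); first exact: ttfc_fib_iso.
  by apply: fT'; apply: above_vcompl.
Qed.

(** * Pullbacks in fibers *)

(** The mediating morphism of [E] is vertical, since its composite with the vertical [q1] is. *)
Lemma fiber_is_pullback {I : B} {P X Y Z : fiber p I} {q1 : Hom P X} {q2 : Hom P Y}
    {f : Hom X Z} {g : Hom Y Z} :
  is_pullback (C := E) (sval q1) (sval q2) (sval f) (sval g) -> is_pullback q1 q2 f g.
Proof.
move=> pb; apply: is_pullback_intro.
- by apply: FibHom_eq; apply: (proj1 pb).
- move=> W a b /(congr1 sval) /= /(is_pullback_lift _ _ pb) [w [w1 w2]].
  have aw : above (A := W) (A' := P) w (idm I).
    by apply: (above_cancel (svalP q1)); rewrite w1; exact: (svalP a).
  by exists (exist _ w aw); split; apply: FibHom_eq.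
- move=> W w w' /(congr1 sval) /= e1 /(congr1 sval) /= e2.
  by apply: FibHom_eq; apply: (is_pullback_ext pb).
Qed.

(** The pullback in [E] lies over a pullback of identities, so both projections lie over the same
    isomorphism. Replacing [P] along its inverse [v] makes them vertical. *)
Lemma vertical_pullback_ex {I : B} {X Y Z : FibObj p I} {f : Hom X Z} {g : Hom Y Z} :
  fibE X Z f -> above f (idm I) -> above g (idm I) ->
  exists (P : FibObj p I) (q1 : Hom P X) (q2 : Hom P Y),
    above q1 (idm I) /\ above q2 (idm I) /\ is_pullback q1 q2 f g.
Proof.
move=> hf af ag; have [P0 [q1 [q2 pb]]] := ttfc_pullback hE g hf.
pose P := Build_FibObj (p := p) (fo_obj := P0) erefl.
have [s1 as1] := above_ex (A := P) (A' := X) q1.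
have [s2 as2] := above_ex (A := P) (A' := Y) q2.
have pbB := is_pullback_base (P := P) hf pb as1 as2 af ag.
have [v [v1 v2]] := is_pullback_lift (idm I) (idm I) pbB erefl.
have [|P' [a [ia aa]]] := vertical_replacement (v := v) P.
  exists s1; split=> //; have e := proj1 pbB; rewrite !comp1m in e.
  by apply: (is_pullback_ext pbB); rewrite compA ?v1 ?v2 comp1m compm1 ?e.
exists P', (q1 ∘ a), (q2 ∘ a); split; last split.
- by rewrite -v1; apply: (above_comp (Y := P)) aa.
- by rewrite -v2; apply: (above_comp (Y := P)) aa.
- exact: is_pullback_iso.
Qed.

(** Pullbacks in the fiber are unique up to isomorphism, and the vertical pullback of [E] is one of
    them. *)
Lemma total_is_pullback {I : B} {P X Y Z : fiber p I} {q1 : Hom P X} {q2 : Hom P Y}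
    {f : Hom X Z} {g : Hom Y Z} :
  fiber_fib p fibE I X Z f -> is_pullback q1 q2 f g ->
  is_pullback (C := E) (sval q1) (sval q2) (sval f) (sval g).
Proof.
move=> hf pb.
have [P' [q1' [q2' [a1 [a2 pb']]]]] := vertical_pullback_ex hf (svalP f) (svalP g).
have pbf : is_pullback (C := fiber p I) (exist _ q1' a1 : Hom (P' : fiber p I) X)
  (exist _ q2' a2 : Hom (P' : fiber p I) Y) f g by apply: fiber_is_pullback.
have [w [/fiber_is_iso iw [<- <-]]] := is_pullback_uniq pbf pb.
exact: (is_pullback_iso _ iw pb').
Qed.

(** * Reindexed squares, acyclic cofibrations and factorizations *)

Lemma reindexed_square {I J : B} {X Y : FibObj p J} {X' Y' : FibObj p I} {f : Hom X Y}
    {f' : Hom X' Y'} {c : Hom X' X} {d : Hom Y' Y} {s : Hom I J} :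
  cartesian p c -> above c s -> cartesian p d -> above d s ->
  above f (idm J) -> above f' (idm I) -> d ∘ f' = f ∘ c -> is_pullback c f' f d.
Proof.
move=> cc ac cd ad af af' e.
apply: (is_pullback_cartesian cd ad cc ac af af' (esym e)); exact: is_pullback_id.
Qed.

Lemma reindexed_fib {I J : B} {X Y : FibObj p J} {X' Y' : FibObj p I} {f : Hom X Y}
    {f' : Hom X' Y'} {c : Hom X' X} {d : Hom Y' Y} {s : Hom I J} :
  cartesian p c -> above c s -> cartesian p d -> above d s ->
  above f (idm J) -> above f' (idm I) -> d ∘ f' = f ∘ c ->
  fibE X Y f -> fibE X' Y' f'.
Proof.
move=> cc ac cd ad af af' e.
exact: (ttfc_pullback_fib hE (reindexed_square cc ac cd ad af af' e)).
Qed.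

(* A fibration of [E] is a vertical one followed by a cartesian morphism, so a
   lifting problem against it reduces to one against a reindexed vertical one. *)
Lemma total_acyclic_cof {J : B} {A A' : fiber p J} {i : Hom A A'} :
  acyclic_cof (fiber_fib p fibE J) i -> acyclic_cof fibE (sval i).
Proof.
move=> ai X0 Y0 q hq f g e.
pose X := Build_FibObj (p := p) (fo_obj := X0) erefl.
pose Y := Build_FibObj (p := p) (fo_obj := Y0) erefl.
have [b aq] := above_ex (A := X) (A' := Y) q.
have [a af] := above_ex (A := A) (A' := X) f.
have ag : above (A := A') (A' := Y) g (b ∘ a).
  have := above_comp aq af; rewrite e => <-; apply/esym.
  by apply: (above_vcomp (X := A) (Z := Y)) (svalP i); apply: above_base.
have [Yb [c [cc ac]]] := cartesian_lift b Y.
have [|u [cu au]] := cartesian_ex (A' := Y) (X := X) (g := q) (idm _) cc ac.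
  by rewrite compm1.
have hu : fibE X Yb u.
  apply: (induced_fib (A := X) (C := Y) hq cc ac au _ cu).
  by apply: (ttfc_fib_iso hB); apply: is_iso_id.
have [g' [cg' ag']] := cartesian_ex (X := A') a cc ac ag.
(* [u] is vertical over [p X]; reindexing it along [a] gives a fibration [u'] in the fiber over [J],
   where [ai] applies. *)
have [Xa [dX [cX aX]]] := cartesian_lift a X.
have [Ya [dY [cY aY]]] := cartesian_lift a Yb.
have [|u' [cu' au']] := cartesian_ex (X := Xa) (g := u ∘ dX) (idm _) cY aY.
  by rewrite compm1; apply: above_vcompl au aX.
have hu' := reindexed_fib cX aX cY aY au au' cu' hu.
have [|f' [cf' af']] := cartesian_ex (A' := X) (X := A) (g := f) (idm _) cX aX.
  by rewrite compm1.
have [|g'' [cg'' ag'']] := cartesian_ex (X := A') (g := g') (idm _) cY aY.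
  by rewrite compm1.
have [|h [/(congr1 sval) /= h1 /(congr1 sval) /= h2]] :=
  ai Xa Ya (exist _ u' au') hu' (exist _ f' af') (exist _ g'' ag'').
{ apply: FibHom_eq => /=; apply: (cartesian_uniq cY).
  - exact: above_vcomp au' af'.
  - exact: above_vcomp ag'' (svalP i).
  - rewrite !compA cu' cg'' -compA cf'; apply: (cartesian_uniq cc).
    + exact: (above_vcompl (X := A) (Y := X)) au af.
    + exact: above_vcomp ag' (svalP i).
    + by rewrite !compA cu cg' e. }
exists (dX ∘ sval h); split; first by rewrite -compA h1 cf'.
by rewrite -cu -compA (compA u) -cu' -compA h2 cg'' cg'.
Qed.

Lemma fiber_acyclic_cof {J : B} {A A' : fiber p J} {i : Hom A A'} :
  acyclic_cof fibE (sval i) -> acyclic_cof (fiber_fib p fibE J) i.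
Proof.
move=> ai X Y q hq f g /(congr1 sval) /= e.
have [h [h1 h2]] := ai _ _ (sval q) hq (sval f) (sval g) e.
have ah : above (A := A') (A' := X) h (idm J).
  by apply: (above_cancel (svalP q)); rewrite h2; exact: (svalP g).
by exists (exist _ h ah); split; apply: FibHom_eq.
Qed.

Lemma cartesian_id {I : B} (A : FibObj p I) : cartesian p (idm (A : E)).
Proof.
apply: (cartesian_intro (above_id A)).
- by move=> K X g r; rewrite comp1m => ag; exists g; rewrite comp1m.
- by move=> K X h h' r _ _; rewrite !comp1m.
Qed.

(* Factor in [E], getting [M0] over the retract [K] of [I], and reindex [M0] along
   the section [I -> K], which is an acyclic cofibration. *)
Lemma vertical_factor {I : B} {A A' : FibObj p I} {f : Hom A A'} :
  above f (idm I) ->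
  exists (M : FibObj p I) (i : Hom A M) (q : Hom M A'),
    above i (idm I) /\ above q (idm I) /\
    acyclic_cof fibE i /\ fibE M A' q /\ q ∘ i = f.
Proof.
move=> af; have [M00 [i0 [q0 [ai0 [hq0 e]]]]] := ttfc_factor hE f.
pose M0 := Build_FibObj (p := p) (fo_obj := M00) erefl.
have [s ab] := above_ex (A := A) (A' := M0) i0.
have [r aq] := above_ex (A := M0) (A' := A') q0.
have rs : r ∘ s = idm I by rewrite -(above_comp aq ab) e.
have [M [c [cc ac]]] := cartesian_lift s M0.
have cof_c := cartesian_acyclic_cof cc ac (acyclic_cof_base (A' := M0) ai0 ab).
have [|i [ci ai]] := cartesian_ex (A' := M0) (X := A) (g := i0) (idm I) cc ac.
  by rewrite compm1.
have [N [d [cd ad]]] := cartesian_lift r A'.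
have [|u [du au]] := cartesian_ex (A' := A') (X := M0) (g := q0) (idm _) cd ad.
  by rewrite compm1.
have hu : fibE M0 N u.
  apply: (induced_fib (A := M0) (C := A') hq0 cd ad au _ du).
  by apply: (ttfc_fib_iso hB); apply: is_iso_id.
(* Since [r ∘ s] is the identity, [j] exhibits [A'] as the reindexing of [N] along [s]. Hence
   [q0 ∘ c] is the reindexing of the vertical fibration [u]. *)
have [|j [dj aj]] := cartesian_ex (X := A') (g := idm (A' : E)) s cd ad.
  by rewrite rs; apply: above_id.
have cj : cartesian p j.
  by apply: (cartesian_cancel cd ad _ aj); rewrite dj; apply: cartesian_id.
have aqc : above (q0 ∘ c) (idm I) by rewrite -rs; apply: (above_comp (Y := M0)) ac.
exists M, i, (q0 ∘ c); split=> //; split=> //; split; last split.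
- by apply: (acyclic_cof_cancel hE cof_c); rewrite ci.
- apply: (reindexed_fib cc ac cj aj au aqc _ hu).
  apply: (cartesian_uniq cd).
  + exact: above_vcomp aj aqc.
  + exact: above_vcompl au ac.
  + by rewrite !compA dj comp1m du.
- by rewrite -compA ci e.
Qed.

(* [p] sends the dependent product of [E] to a dependent product of an identity,
   which is an isomorphism; reindexing along it makes the product vertical. *)
Lemma vertical_dp_ex {I J : B} {A A' : FibObj p I} {Z : FibObj p J} {f : Hom A A'}
    {g : Hom A' Z} {s : Hom I J} :
  fibE A A' f -> fibE A' Z g -> above f (idm I) -> above g s ->
  exists (D : FibObj p J) (pi : Hom D Z), above pi (idm J) /\ fibE D Z pi /\
    forall (Q : E) (r1 : Hom Q D) (r2 : Hom Q A'), is_pullback r1 r2 pi g ->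
      exists ev : Hom Q A, dp_universal f g pi r1 r2 ev.
Proof.
move=> hf hg af ag; have [D0 [pi0 [hpi0 [d]]]] := ttfc_dep_prod hE hf hg.
pose D := Build_FibObj (p := p) (fo_obj := D0) erefl.
have [k ak] := above_ex (A := D) (A' := Z) pi0.
have [dB] := DepProd_base (D := D) hf hg hpi0 d af ag ak.
have hk : fibB _ _ k := fib_base (A := D) hpi0 ak.
have [QB [s1 [s2 pbB]]] := ttfc_pullback hB s hk.
have [v [vk kv]] := DepProd_of_iso (is_iso_id I) pbB dB.
have [|D' [a [ia aa]]] := vertical_replacement (v := v) D.
  by exists k.
exists D', (pi0 ∘ a); split; last split.
- by rewrite -kv; apply: (above_comp (Y := D)) ak aa.
- exact: (fib_comp_iso hE hpi0 ia).
- move=> Q r1 r2 pb; have [Q0 [q1 [q2 pb0]]] := ttfc_pullback hE g hpi0.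
  have [u _] := DepProd_universal d pb0; set ev := sval _ in u.
  have [|b [b1 b2]] := is_pullback_lift (a ∘ r1) r2 pb0.
    by rewrite compA (proj1 pb).
  by exists (ev ∘ b); apply: (dp_universal_iso a b ia _ b1 b2 _ pb u).
Qed.

(** Pullbacks along the fibration [g] in the fiber are pullbacks in [E]. The maps [k] and [w] found
    in [E] are vertical because their composites with the vertical [pi] and [r2] are. *)
Lemma fiber_dp_universal {I : B} {A A' Z D Q : fiber p I} {f : Hom A A'} {g : Hom A' Z}
    {pi : Hom D Z} {r1 : Hom Q D} {r2 : Hom Q A'} {ev : Hom Q A} :
  fiber_fib p fibE I A' Z g ->
  dp_universal (C := E) (sval f) (sval g) (sval pi) (sval r1) (sval r2) (sval ev) ->
  dp_universal f g pi r1 r2 ev.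
Proof.
move=> hg u; split.
- exact: fiber_is_pullback (dpu_pb u).
- by apply: FibHom_eq; apply: (dpu_ev u).
- move=> X P h q1 q2 e pb /(congr1 sval) /= fe.
  have pbE := is_pullback_sym (total_is_pullback hg (is_pullback_sym pb)).
  have [k [w [pk [w1 [w2 ew]]]]] := dpu_ex u pbE fe.
  have ak : above (A := X) (A' := D) k (idm I).
    by apply: (above_cancel (svalP pi)); rewrite pk; exact: (svalP h).
  have aw : above (A := P) (A' := Q) w (idm I).
    by apply: (above_cancel (svalP r2)); rewrite w2; exact: (svalP q2).
  by exists (exist _ k ak), (exist _ w aw); repeat split; apply: FibHom_eq.
- move=> X P h q1 q2 k k' w w' pb.
  have pbE := is_pullback_sym (total_is_pullback hg (is_pullback_sym pb)).
  move=> /(congr1 sval) e1 /(congr1 sval) e2 /(congr1 sval) e3 /(congr1 sval) e4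
    /(congr1 sval) e5 /(congr1 sval) e6 /(congr1 sval) e7.
  by apply: FibHom_eq; apply: (dpu_uniq u pbE e1 e2 e3 e4 e5 e6 e7).
Qed.

(** As for pullbacks: the given dependent product is isomorphic in the fiber to a vertical one of
    [E], whose universal property is transported along the isomorphism. *)
Lemma total_dp_universal {I : B} {A A' Z D Q : fiber p I} {f : Hom A A'} {g : Hom A' Z}
    {pi : Hom D Z} {r1 : Hom Q D} {r2 : Hom Q A'} {ev : Hom Q A} :
  fiber_fib p fibE I A A' f -> fiber_fib p fibE I A' Z g ->
  dp_universal f g pi r1 r2 ev ->
  dp_universal (C := E) (sval f) (sval g) (sval pi) (sval r1) (sval r2) (sval ev).
Proof.
move=> hf hg u.
have [D' [pi' [api' [hpi' ex]]]] := vertical_dp_ex hf hg (svalP f) (svalP g).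
have [Q' [r1' [r2' [a1 [a2 pb']]]]] := vertical_pullback_ex hpi' api' (svalP g).
have [ev' u'] := ex Q' r1' r2' pb'.
have aev : above (A := Q') (A' := A) ev' (idm I).
  by apply: (above_cancel (svalP f)); rewrite (dpu_ev u').
have uf : dp_universal f g (exist _ pi' api' : Hom (D' : fiber p I) Z)
    (exist _ r1' a1 : Hom (Q' : fiber p I) D')
    (exist _ r2' a2 : Hom (Q' : fiber p I) A') (exist _ ev' aev : Hom (Q' : fiber p I) A).
  exact: fiber_dp_universal.
have [a [b [/fiber_is_iso ia [/(congr1 sval) e1 [/(congr1 sval) e2 [/(congr1 sval) e3
  /(congr1 sval) e4]]]]]] := dp_universal_uniq uf u.
apply: (dp_universal_iso (sval a) (sval b) ia e1 e2 e3 e4 _ u').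
exact: is_pullback_sym (total_is_pullback hg (is_pullback_sym (dpu_pb u))).
Qed.

Lemma fiber_ttfc (I : B) : is_ttfc (fiber_fib p fibE I).
Proof.
split.
- have [T [hT _]] := fiberwise_terminal_ex I.
  by exists T; apply: fiberwise_terminal_fiber.
- by move=> X Y Z g f; apply: (ttfc_fib_comp hE).
- by move=> X Y f /fiber_is_iso; apply: (ttfc_fib_iso hE).
- by move=> X T f /fiber_terminalP [_]; apply; exact: (svalP f).
- move=> X Y Z f g hf.
  have [P [q1 [q2 [a1 [a2 pb]]]]] := vertical_pullback_ex hf (svalP f) (svalP g).
  exists P, (exist _ q1 a1), (exist _ q2 a2).
  exact: (fiber_is_pullback (P := P)).
- move=> X Y Z P q1 q2 f g pb hf.
  exact: (ttfc_pullback_fib hE (total_is_pullback hf pb) hf).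
- move=> X Y f; have [M [i [q [ai [aq [ci [hq e]]]]]]] := vertical_factor (svalP f).
  exists M, (exist _ i ai), (exist _ q aq); split; last split=> //.
  + exact: fiber_acyclic_cof.
  + exact: FibHom_eq.
- move=> A A' Z f g hf hg.
  have [D [pi [api [hpi ex]]]] := vertical_dp_ex hf hg (svalP f) (svalP g).
  have [Q [r1 [r2 [a1 [a2 pb]]]]] := vertical_pullback_ex hpi api (svalP g).
  have [ev u] := ex Q r1 r2 pb.
  have aev : above (A := Q) (A' := A) ev (idm I).
    by apply: (above_cancel (svalP f)); rewrite (dpu_ev u).
  exists D, (exist _ pi api); split=> //.
  have uf : dp_universal f g (exist _ pi api : Hom (D : fiber p I) Z)
      (exist _ r1 a1 : Hom (Q : fiber p I) D)
      (exist _ r2 a2 : Hom (Q : fiber p I) A') (exist _ ev aev : Hom (Q : fiber p I) A).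
    exact: fiber_dp_universal.
  by have [d _] := universal_DepProd uf.
Qed.

(** * Reindexing *)

(* Pullback along a fibration followed by reindexing along an acyclic cofibration. *)
Lemma reindexed_acyclic_cof {I J : B} {A A' : FibObj p J} {X X' : FibObj p I}
    {i : Hom A A'} {i' : Hom X X'} {c : Hom X A} {d : Hom X' A'} {s : Hom I J} :
  cartesian p c -> above c s -> cartesian p d -> above d s ->
  above i (idm J) -> above i' (idm I) -> d ∘ i' = i ∘ c ->
  acyclic_cof fibE i -> acyclic_cof fibE i'.
Proof.
move=> cc ac cd ad ai ai' e cof_i.
have [K [j [t [cof_j [ht ts]]]]] := ttfc_factor hB s.
have [A1 [c1 [cc1 ac1]]] := cartesian_lift t A.
have [A1' [d1 [cd1 ad1]]] := cartesian_lift t A'.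
have [|i1 [di1 ai1]] := cartesian_ex (X := A1) (g := i ∘ c1) (idm K) cd1 ad1.
  by rewrite compm1; apply: above_vcompl.
have sq := reindexed_square cc1 ac1 cd1 ad1 ai ai1 di1.
have cof_i1 := acyclic_cof_pullback hE sq (cartesian_fib cd1 ad1 ht) cof_i.
have [|u [cu au]] := cartesian_ex (g := c) j cc1 ac1; first by rewrite ts.
have [|v [dv av]] := cartesian_ex (g := d) j cd1 ad1; first by rewrite ts.
have cof_u : acyclic_cof fibE u.
  apply: (cartesian_acyclic_cof _ au cof_j).
  by apply: (cartesian_cancel cc1 ac1 _ au); rewrite cu.
have cof_v : acyclic_cof fibE v.
  apply: (cartesian_acyclic_cof _ av cof_j).
  by apply: (cartesian_cancel cd1 ad1 _ av); rewrite dv.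
(* Both [u] and [v] are cartesian above the acyclic cofibration [j], and [i1] is a pullback of [i]
   along a fibration. So [v ∘ i'], which equals [i1 ∘ u], is an acyclic cofibration, and [v] can be
   cancelled. *)
apply: (acyclic_cof_cancel hE cof_v).
have -> : v ∘ i' = i1 ∘ u.
{ apply: (cartesian_uniq cd1).
  - exact: above_vcomp av ai'.
  - exact: above_vcompl ai1 au.
  - by rewrite !compA dv di1 e -compA cu. }
exact: acyclic_cof_comp.
Qed.

Section Reindexing.
Context (cl : Cleavage p).

(** The cartesian lifting, retyped with source a value of the functor [reindex cl s], so that it
    composes with the images of morphisms under this functor. *)
Definition rlift {I J : B} (s : Hom I J) (A : fiber p J) :
    Hom (c := E) (reindex cl s A : FibObj p I) (A : FibObj p J) :=
  cl_lift cl s A.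

Lemma rlift_cartesian {I J : B} (s : Hom I J) (A : fiber p J) :
  cartesian p (rlift s A).
Proof. exact: cl_cartesian. Qed.

Lemma rlift_above {I J : B} (s : Hom I J) (A : fiber p J) :
  above (A := reindex cl s A) (A' := A) (rlift s A) s.
Proof. exact: cl_above. Qed.

Lemma rliftE {I J : B} (s : Hom I J) {A A' : fiber p J} (f : Hom A A') :
  rlift s A' ∘ sval (fmap (reindex cl s) f) = sval f ∘ rlift s A.
Proof. exact: (reindex_morE cl s f). Qed.

(** Together with [rlift_uniq] and [above_rlift], this identifies vertical morphisms into the
    reindexing of [A] with morphisms of [E] to [A] above [s]. *)
Lemma rlift_ex {I J : B} (s : Hom I J) {X : fiber p I} {A : fiber p J}
    (g : Hom (c := E) (X : FibObj p I) (A : FibObj p J)) :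
  above g s -> exists h : Hom X (reindex cl s A), rlift s A ∘ sval h = g.
Proof.
move=> ag; have [|h [e ah]] := cartesian_ex (X := X) (g := g) (idm I)
  (rlift_cartesian s A) (rlift_above s A); first by rewrite compm1.
by exists (exist _ h ah).
Qed.

Lemma rlift_uniq {I J : B} (s : Hom I J) {X : fiber p I} {A : fiber p J}
    {h h' : Hom X (reindex cl s A)} :
  rlift s A ∘ sval h = rlift s A ∘ sval h' -> h = h'.
Proof.
move=> e; apply: FibHom_eq.
exact: (cartesian_uniq (rlift_cartesian s A) (svalP h) (svalP h') e).
Qed.

Lemma above_rlift {I J : B} (s : Hom I J) {X : fiber p I} {A : fiber p J}
    (h : Hom X (reindex cl s A)) :
  above (A := X) (A' := A) (rlift s A ∘ sval h) s.
Proof. exact: (above_vcomp (rlift_above s A) (svalP h)). Qed.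

Lemma rlift_square {I J : B} (s : Hom I J) {X Y : fiber p J} (f : Hom X Y) :
  is_pullback (C := E) (rlift s X) (sval (fmap (reindex cl s) f)) (sval f) (rlift s Y).
Proof.
exact: (reindexed_square (rlift_cartesian s X) (rlift_above s X) (rlift_cartesian s Y)
  (rlift_above s Y) (svalP f) (svalP (fmap (reindex cl s) f)) (rliftE s f)).
Qed.

(** * Structure preserved by reindexing *)

Lemma reindex_preserves_fib {I J : B} (s : Hom I J) :
  preserves_fib (fiber_fib p fibE J) (fiber_fib p fibE I) (reindex cl s).
Proof.
move=> X Y f hf.
exact: (ttfc_pullback_fib hE (rlift_square s f) hf).
Qed.

Lemma reindex_preserves_terminal {I J : B} (s : Hom I J) :
  preserves_terminal (reindex cl s).
Proof.
move=> T /fiber_terminalP [[ex un] _] X.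
have [g ag] := ex I X s; have [h _] := rlift_ex s (X := X) g ag.
exists h; split=> // h' _; apply: rlift_uniq.
exact: (un I X s _ _ (above_rlift s h) (above_rlift s h')).
Qed.

(** A cone over the reindexed cospan is a cone of [E] above [s] over the original cospan, whose
    pullback in the fiber is also one in [E]. *)
Lemma reindex_preserves_pullback {I J : B} (s : Hom I J) :
  preserves_pullback_fib (fiber_fib p fibE J) (reindex cl s).
Proof.
move=> X Y Z P q1 q2 f g hf pb; have pbE := total_is_pullback hf pb.
apply: is_pullback_intro; first by rewrite -!fmapM (proj1 pb).
- move=> W a b e.
  have [|w [w1 w2]] := is_pullback_lift (rlift s X ∘ sval a) (rlift s Y ∘ sval b) pbE.
    by rewrite !compA -!rliftE -!compA; congr (_ ∘ _); apply: (congr1 sval e).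
  have aw : above (A := W) (A' := P) w s.
    by apply: (above_cancel (svalP q1)); rewrite w1; apply: above_rlift.
  have [h hw] := rlift_ex s (X := W) w aw.
  exists h; split; apply: rlift_uniq => /=.
  + by rewrite compA (rliftE s q1) -compA hw w1.
  + by rewrite compA (rliftE s q2) -compA hw w2.
- move=> W h h' /(congr1 sval) /= e1 /(congr1 sval) /= e2; apply: rlift_uniq.
  apply: (is_pullback_ext pbE).
  + by rewrite !compA -!(rliftE s q1) -!compA e1.
  + by rewrite !compA -!(rliftE s q2) -!compA e2.
Qed.

Lemma reindex_preserves_acyclic_cof {I J : B} (s : Hom I J) :
  preserves_fib (acyclic_cof (fiber_fib p fibE J)) (acyclic_cof (fiber_fib p fibE I))
    (reindex cl s).
Proof.
move=> X Y i /total_acyclic_cof hi; apply: fiber_acyclic_cof.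
exact: (reindexed_acyclic_cof (rlift_cartesian s X) (rlift_above s X)
  (rlift_cartesian s Y) (rlift_above s Y) (svalP i)
  (svalP (fmap (reindex cl s) i)) (rliftE s i) hi).
Qed.

(** Pasting with [rlift_square] turns a pullback along the reindexed [g] into a pullback in [E]
    along [g] itself. The universal property of the product in [E], used for morphisms above [s], is
    then that of its reindexing. *)
Lemma reindex_dp_universal {I J : B} (s : Hom I J) {A A' Z D Q : fiber p J}
    {f : Hom A A'} {g : Hom A' Z} {pi : Hom D Z} {r1 : Hom Q D} {r2 : Hom Q A'}
    {ev : Hom Q A} :
  fiber_fib p fibE J A A' f -> fiber_fib p fibE J A' Z g ->
  dp_universal f g pi r1 r2 ev ->
  let F := reindex cl s in
  dp_universal (fmap F f) (fmap F g) (fmap F pi) (fmap F r1) (fmap F r2) (fmap F ev).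
Proof.
move=> hf hg u F; have uE := total_dp_universal hf hg u.
have hFg : fiber_fib p fibE I _ _ (fmap F g) by apply: reindex_preserves_fib.
have paste X P (h : Hom X (F Z)) (q1 : Hom P X) (q2 : Hom P (F A')) :
    is_pullback q1 q2 h (fmap F g) ->
    is_pullback (C := E) (sval q1) (rlift s A' ∘ sval q2) (rlift s Z ∘ sval h) (sval g).
  move=> pb; apply: (is_pullback_paste _ (is_pullback_sym (rlift_square s g))).
  exact: is_pullback_sym (total_is_pullback hFg (is_pullback_sym pb)).
split.
- apply: is_pullback_sym; apply: reindex_preserves_pullback => //.
  exact: is_pullback_sym (dpu_pb u).
- by rewrite -fmapM (dpu_ev u).
- move=> X P h q1 q2 e /paste pb /(congr1 sval) /= fe.
  have [|k [w [pk [w1 [w2 ew]]]]] := dpu_ex uE (e := rlift s A ∘ sval e) pb.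
    by rewrite compA -(rliftE s f) -compA fe.
  have ak : above (A := X) (A' := D) k s.
    by apply: (above_cancel (svalP pi)); rewrite pk; apply: above_rlift.
  have aw : above (A := P) (A' := Q) w s.
    by apply: (above_cancel (svalP r2)); rewrite w2; apply: above_rlift.
  have [k' ek] := rlift_ex s (X := X) k ak.
  have [w' ew'] := rlift_ex s (X := P) w aw.
  exists k', w'; split; last split; last split; apply: rlift_uniq => /=.
  + by rewrite compA (rliftE s pi) -compA ek.
  + by rewrite !compA (rliftE s r1) ek -compA ew' w1.
  + by rewrite compA (rliftE s r2) -compA ew' w2.
  + by rewrite compA (rliftE s ev) -compA ew' ew.
- move=> X P h q1 q2 k k' w w' /paste pb e1 e2 e3 e4 e5 e6 e7; apply: rlift_uniq.
  apply: (dpu_uniq uE (w := rlift s Q ∘ sval w) (w' := rlift s Q ∘ sval w') pb).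
  + by rewrite compA -(rliftE s pi) -compA -e1.
  + by rewrite compA -(rliftE s pi) -compA -e2.
  + by rewrite compA -(rliftE s r1) -!compA; congr (_ ∘ _); apply: (congr1 sval e3).
  + by rewrite compA -(rliftE s r1) -!compA; congr (_ ∘ _); apply: (congr1 sval e4).
  + by rewrite compA -(rliftE s r2) -!compA -e5.
  + by rewrite compA -(rliftE s r2) -!compA -e6.
  + by rewrite !compA -(rliftE s ev) -!compA; congr (_ ∘ _); apply: (congr1 sval e7).
Qed.

(** Transposes are computed as [ev ∘ w] on both sides, and the functor carries this formula for [d]
    to the one for [d']. *)
Lemma reindex_preserves_dep_prod {I J : B} (s : Hom I J) :
  preserves_dep_prod (fiber_fib p fibE J) (reindex cl s).
Proof.
move=> A A' Z D f g pi hf hg hpi d.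
have [Q [r1 [r2 pbQ]]] := ttfc_pullback (fiber_ttfc J) g hpi.
have [u ud] := DepProd_universal d pbQ; set ev := sval _ in u ud.
have [d' ud'] := universal_DepProd (reindex_dp_universal s hf hg u).
exists d' => X P h q1 q2 pb pb' k k' e.
have [|w [w1 w2]] := is_pullback_lift (sval k ∘ q1) q2 pbQ.
  by rewrite compA (svalP k) (proj1 pb).
rewrite (ud _ _ _ _ _ pb k w) // fmapM; apply: ud'.
- by rewrite e -!fmapM w1.
- by rewrite -fmapM w2.
Qed.

Lemma reindex_tt_functor {I J : B} (s : Hom I J) :
  is_tt_functor (fiber_fib p fibE J) (fiber_fib p fibE I) (reindex cl s).
Proof.
split.
- exact: fiber_ttfc.
- exact: fiber_ttfc.
- exact: reindex_preserves_terminal.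
- exact: reindex_preserves_fib.
- exact: reindex_preserves_pullback.
- exact: reindex_preserves_acyclic_cof.
- exact: reindex_preserves_dep_prod.
Qed.

(** The cartesian lifting to [W] is an acyclic cofibration of [E], so [rlift s X ∘ sval u] extends
    along it to a lift of [g] through the fibration [f]. *)
Lemma reindex_weakly_cartesian {I J : B} (s : Hom I J) {X Y : fiber p J} (f : Hom X Y) :
  acyclic_cof fibB s -> fiber_fib p fibE J X Y f ->
  weakly_cartesian (reindex cl s) f.
Proof.
move=> cof_s hf W g u /(congr1 sval) /= e.
have cof_c := cartesian_acyclic_cof (rlift_cartesian s W) (rlift_above s W) cof_s.
have [|h [h1 h2]] := cof_c _ _ _ hf (rlift s X ∘ sval u) (sval g).
  by rewrite compA -(rliftE s f) -compA e (rliftE s g).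
have ah : above (A := W) (A' := X) h (idm J).
  by apply: (above_cancel (svalP f)); rewrite h2; exact: (svalP g).
exists (exist _ h ah); split; first exact: FibHom_eq.
by apply: rlift_uniq; rewrite rliftE.
Qed.

(** * Right adjoints of reindexing *)

(** The universal property of [s_* A] with respect to all base changes of [s]. *)
Definition stably_couniversal {I J : B} (s : Hom I J) {A : fiber p I} {D : fiber p J}
    (ev : Hom (reindex cl s D) A) : Prop :=
  forall (I' J' : B) (t : Hom I' I) (s' : Hom I' J') (r : Hom J' J),
    is_pullback t s' s r ->
  forall (X : FibObj p J') (X' : FibObj p I') (c : Hom X' X),
    cartesian p c -> above c s' ->
  (forall e : Hom X' (A : FibObj p I), above e t ->
    exists (k : Hom X (D : FibObj p J)) (w : Hom X' (reindex cl s D : FibObj p I)),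
      above k r /\ above w t /\ rlift s D ∘ w = k ∘ c /\ sval ev ∘ w = e) /\
  (forall (k k' : Hom X (D : FibObj p J)) (w w' : Hom X' (reindex cl s D : FibObj p I)),
    above k r -> above k' r -> above w t -> above w' t ->
    rlift s D ∘ w = k ∘ c -> rlift s D ∘ w' = k' ∘ c ->
    sval ev ∘ w = sval ev ∘ w' -> k = k').

(* [s_* A] is the dependent product of [A -> s^* 1] along the cartesian fibration
   [s^* 1 -> 1] over [s]. *)
Lemma stably_couniversal_ex {I J : B} (s : Hom I J) (A : fiber p I) :
  fibB I J s ->
  exists (D : fiber p J) (ev : Hom (reindex cl s D) A), stably_couniversal s ev.
Proof.
move=> hs; have [T [tT _]] := fiberwise_terminal_ex J.
have [[exT' unT'] fT'] := fiber_terminalP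
  (reindex_preserves_terminal s _ (fiberwise_terminal_fiber tT)).
have [exT unT] := tT.
have [f af] := exT' I A (idm I); have hf := fT' _ _ af.
have ac := rlift_above s (T : fiber p J); have cc := rlift_cartesian s (T : fiber p J).
have [D [pi [api [hpi ex]]]] := vertical_dp_ex hf (cartesian_fib cc ac hs) af ac.
pose pif : Hom (D : fiber p J) T := exist _ pi api.
have [ev u] := ex _ _ _ (rlift_square s pif).
have aev : above (A := reindex cl s D) (A' := A) ev (idm I).
  by apply: (above_cancel af); rewrite (dpu_ev u); exact: (svalP (fmap (reindex cl s) pif)).
exists D, (exist _ ev aev) => I' J' t s' r pb X X' c cX aX.
have [x ax] := exT J' X r; have [x' ax'] := exT' I' X' t.
have e : x ∘ c = rlift s T ∘ x'.
  apply: (unT _ _ _ _ _ (above_comp ax aX)).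
  by rewrite -(proj1 pb); apply: above_comp ac ax'.
(* [c] is a base change of the cartesian morphism to [T], so the universal property [u] covers
   objects [X] above an arbitrary [r]. *)
have pbE := is_pullback_cartesian cc ac cX aX ax ax' e (is_pullback_sym pb).
split.
- move=> a aa; have [|k [w [pk [w1 [w2 ew]]]]] := dpu_ex u (e := a) pbE.
    by apply: (unT' _ _ _ _ _ _ ax'); apply: above_vcompl af aa.
  exists k, w; split; last split=> //.
  + by apply: (above_cancel api); rewrite pk.
  + by apply: (above_cancel (svalP (fmap (reindex cl s) pif))); rewrite w2.
- move=> k k' w w' ak ak' aw aw' e1 e2 e3.
  apply: (dpu_uniq u pbE _ _ e1 e2 _ _ e3).
  + exact: (unT _ _ _ _ _ (above_vcompl api ak)).
  + exact: (unT _ _ _ _ _ (above_vcompl api ak')).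
  + exact: (unT' _ _ _ _ _ (above_vcompl (svalP (fmap (reindex cl s) pif)) aw)).
  + exact: (unT' _ _ _ _ _ (above_vcompl (svalP (fmap (reindex cl s) pif)) aw')).
Qed.

(** This is the case where [r] is an identity and [c] the chosen lifting; there [w] must be the
    reindexing of [k], since both agree after the cartesian lifting to [D]. *)
Lemma stably_couniversal_couniversal {I J : B} (s : Hom I J) {A : fiber p I}
    {D : fiber p J} {ev : Hom (reindex cl s D) A} :
  stably_couniversal s ev -> couniversal ev.
Proof.
move=> u X e; have [ex un] := u _ _ _ _ _ (is_pullback_sym (is_pullback_id s)) X
  (reindex cl s X) (rlift s X) (rlift_cartesian s X) (rlift_above s X).
have [k [w [ak [aw [w1 w2]]]]] := ex (sval e) (svalP e).
exists (exist _ k ak); split.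
- apply: FibHom_eq; rewrite /= -w2; congr (_ ∘ _).
  have := rlift_uniq s (h := fmap (reindex cl s) (exist _ k ak : Hom X D))
    (h' := exist _ w aw).
  by rewrite rliftE => /(_ (esym w1)) /(congr1 sval).
- move=> k' /(congr1 sval) /= e'; apply: FibHom_eq => /=.
  apply: (un k (sval k') w (sval (fmap (reindex cl s) k'))) => //.
  + exact: (svalP k').
  + exact: (svalP (fmap (reindex cl s) k')).
  + exact: rliftE.
  + by rewrite w2.
Qed.

(** Universal arrows to [A] are isomorphic, so stability passes from the constructed one to the
    counit of any given adjunction. *)
Lemma stably_couniversal_transfer {I J : B} (s : Hom I J) {A : fiber p I}
    {D D' : fiber p J} {ev : Hom (reindex cl s D) A} {ev' : Hom (reindex cl s D') A} :
  stably_couniversal s ev -> couniversal ev' -> stably_couniversal s ev'.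
Proof.
move=> u uev'; have uev := stably_couniversal_couniversal s u.
have [a [ea _]] := uev _ ev'; have [b [eb _]] := uev' _ ev.
have ba : b ∘ a = idm D'.
  by apply: (couniversal_uniq uev'); rewrite fmapM compA eb ea fmap1 compm1.
move=> I' J' t s' r pb X X' c cX aX; have [ex un] := u _ _ _ _ _ pb X X' c cX aX.
split.
- move=> e ae; have [k [w [ak [aw [w1 w2]]]]] := ex e ae.
  exists (sval b ∘ k), (sval (fmap (reindex cl s) b) ∘ w); split; last split; last split.
  + exact: (above_vcompl (svalP b) ak).
  + exact: (above_vcompl (svalP (fmap (reindex cl s) b)) aw).
  + by rewrite compA rliftE -!compA w1.
  + by rewrite compA -w2 -eb.
- move=> k k' w w' ak ak' aw aw' e1 e2 e3.
  have bak : sval b ∘ (sval a ∘ k) = k.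
    by rewrite compA -[RHS]comp1m; congr (_ ∘ _); apply: (congr1 sval ba).
  have bak' : sval b ∘ (sval a ∘ k') = k'.
    by rewrite compA -[RHS]comp1m; congr (_ ∘ _); apply: (congr1 sval ba).
  rewrite -bak -bak'; congr (_ ∘ _).
  apply: (un _ _ (sval (fmap (reindex cl s) a) ∘ w) (sval (fmap (reindex cl s) a) ∘ w')).
  + exact: (above_vcompl (svalP a) ak).
  + exact: (above_vcompl (svalP a) ak').
  + exact: (above_vcompl (svalP (fmap (reindex cl s) a)) aw).
  + exact: (above_vcompl (svalP (fmap (reindex cl s) a)) aw').
  + by rewrite compA rliftE -!compA e1.
  + by rewrite compA rliftE -!compA e2.
  + have /= := congr1 sval ea; rewrite !compA => ->; exact: e3.
Qed.

Lemma reindex_right_adjoint_ex {I J : B} (s : Hom I J) : fibB I J s ->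
  exists sR : Functor (fiber p I) (fiber p J), inhabited (Adjunction (reindex cl s) sR).
Proof.
move=> hs; apply: right_adjoint_ex => A.
have [D [ev u]] := stably_couniversal_ex s A hs.
by exists D, ev; apply: (stably_couniversal_couniversal s u).
Qed.

Lemma counit_stably_couniversal {I J : B} (s : Hom I J)
    {sR : Functor (fiber p I) (fiber p J)} (adj : Adjunction (reindex cl s) sR)
    (A : fiber p I) : fibB I J s -> stably_couniversal s (adj_counit adj A).
Proof.
move=> hs; have [D [ev u]] := stably_couniversal_ex s A hs.
exact: (stably_couniversal_transfer s u (counit_couniversal adj A)).
Qed.

(* [s_* f] is identified with the dependent product [N] along [s^* s_* A' -> s_* A']
   of the pullback [R] of [f] along the counit at [A']. *)
Lemma right_adjoint_preserves_fib {I J : B} (s : Hom I J)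
    {sR : Functor (fiber p I) (fiber p J)} (adj : Adjunction (reindex cl s) sR) :
  fibB I J s -> preserves_fib (fiber_fib p fibE I) (fiber_fib p fibE J) sR.
Proof.
move=> hs A A' f hf; set F := reindex cl s.
pose eps : Hom (F (sR A)) A := adj_counit adj A.
pose eps' : Hom (F (sR A')) A' := adj_counit adj A'.
have ueps : couniversal eps := counit_couniversal adj A.
have ueps' : couniversal eps' := counit_couniversal adj A'.
pose phi := fmap sR f.
have nat : eps' ∘ fmap F phi = f ∘ eps := nt_natural (adj_counit adj) f.
have [R [q1 [q2 pbR]]] := ttfc_pullback (fiber_ttfc I) eps' hf.
have hq2 : fiber_fib p fibE I _ _ q2 := ttfc_pullback_fib (fiber_ttfc I) pbR hf.
have cD := rlift_cartesian s (sR A'); have aD := rlift_above s (sR A').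
have [N0 [n0 [an [hn ex]]]] := vertical_dp_ex hq2 (cartesian_fib cD aD hs) (svalP q2) aD.
pose N : fiber p J := N0; pose n : Hom N (sR A') := exist _ n0 an.
have [ev0 u] := ex _ _ _ (rlift_square s n).
have aev : above (A := F N) (A' := R) ev0 (idm I).
  by apply: (above_cancel (svalP q2)); rewrite (dpu_ev u); apply: (svalP (fmap F n)).
pose ev : Hom (F N) R := exist _ ev0 aev.
have evE : q2 ∘ ev = fmap F n by apply: FibHom_eq; apply: (dpu_ev u).
pose a := q1 ∘ ev.
have fa : f ∘ a = eps' ∘ fmap F n by rewrite compA (proj1 pbR) -compA evE.
(* By [exN] and [unN], maps [X -> N] correspond to pairs [k'], [e] with [f ∘ e = eps' ∘ fmap F k'].
   By adjunction such a pair amounts to the transpose of [e], a map [X -> sR A], so [N] and [sR A]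
   represent the same functor. *)
have exN X (k' : Hom X (sR A')) (e : Hom (F X) A) : f ∘ e = eps' ∘ fmap F k' ->
    exists k : Hom X N, n ∘ k = k' /\ a ∘ fmap F k = e.
  move=> fe; have [e2 [e21 e22]] := is_pullback_lift _ _ pbR fe.
  have [|k [w [pk [w1 [w2 ew]]]]] := dpu_ex u (e := sval e2) (rlift_square s k').
    exact: (congr1 sval e22).
  have ak : above (A := X) (A' := N) k (idm J).
    by apply: (above_cancel an); rewrite pk; apply: (svalP k').
  have aw : above (A := F X) (A' := F N) w (idm I).
    by apply: (above_cancel (svalP (fmap F n))); rewrite w2; apply: (svalP (fmap F k')).
  exists (exist _ k ak); split; first exact: FibHom_eq.
  have <- : exist _ w aw = fmap F (exist _ k ak : Hom X N).
    by apply: (rlift_uniq s (A := N)); rewrite rliftE.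
  rewrite -e21 -compA; congr (_ ∘ _); exact: FibHom_eq.
have unN X (k k' : Hom X N) : n ∘ k = n ∘ k' -> a ∘ fmap F k = a ∘ fmap F k' -> k = k'.
{ move=> e1 e2; apply: FibHom_eq.
  apply: (dpu_uniq u (rlift_square s (n ∘ k)) _ _ (rliftE s k) (rliftE s k')).
  - by [].
  - by rewrite e1.
  - exact: (congr1 sval (esym (fmapM F n k))).
  - by rewrite e1; exact: (congr1 sval (esym (fmapM F n k'))).
  - suff e3 : ev ∘ fmap F k = ev ∘ fmap F k' by exact: (congr1 sval e3).
    apply: (is_pullback_ext pbR); first by rewrite !compA.
    by rewrite !compA evE -!fmapM e1. }
(* [th] corresponds to the pair [phi], [eps]; its inverse [th'] is the transpose of [a]. *)
have [th [th1 th2]] := exN _ phi eps (esym nat).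
have [th' [e' _]] := ueps _ a.
have th'1 : phi ∘ th' = n.
  by apply: (couniversal_uniq ueps'); rewrite fmapM compA nat -compA e' fa.
have ith : is_iso th.
{ exists th'; split.
  - by apply: (couniversal_uniq ueps); rewrite fmapM compA e' th2 fmap1 compm1.
  - apply: unN; first by rewrite compA th1 th'1 compm1.
    by rewrite fmapM compA th2 e' fmap1 compm1. }
rewrite -[fmap sR f]/phi -th1.
exact: (fib_comp_iso (fiber_ttfc J) (hn : fiber_fib p fibE J _ _ n) ith).
Qed.

(** The Beck-Chevalley map is the transpose under [adj'] of [fmap (reindex cl t) eps ∘ sq], so it
    suffices that this is a universal arrow. That is the stable universality of [eps] over the
    square [pb], read through the cartesian liftings. *)
Lemma beck_chevalley_iso {I J I' J' : B} {s : Hom I J} {r : Hom J' J} {t : Hom I' I}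
    {s' : Hom I' J'} (hs : fibB I J s) (pb : is_pullback t s' s r)
    {sR : Functor (fiber p I) (fiber p J)} (adj : Adjunction (reindex cl s) sR)
    {sR' : Functor (fiber p I') (fiber p J')} (adj' : Adjunction (reindex cl s') sR') :
  is_nat_iso (beck_chevalley (proj1 pb) adj adj').
Proof.
move=> A; pose eps : Hom (reindex cl s (sR A)) A := adj_counit adj A.
pose sq : Hom (reindex cl s' (reindex cl r (sR A))) (reindex cl t (reindex cl s (sR A))) :=
  reindex_sq cl (proj1 pb) (sR A).
have sqE : rlift s (sR A) ∘ (rlift t (reindex cl s (sR A)) ∘ sval sq) =
    rlift r (sR A) ∘ rlift s' (reindex cl r (sR A)) :=
  reindex_sq_compE cl (proj1 pb) (sR A).
suff u : couniversal (fmap (reindex cl t) eps ∘ sq).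
  by have := couniversal_transpose_iso adj' u; rewrite fmapM.
move=> X e; have [ex un] := counit_stably_couniversal s adj A hs _ _ _ _ _ pb X
  (reindex cl s' X) (rlift s' X) (rlift_cartesian s' X) (rlift_above s' X).
(* Composed with the lifting over [t], [sq ∘ fmap (reindex cl s') k] is the component [w] that goes
   with the morphism [rlift r (sR A) ∘ sval k] above [r]. *)
have wE (k : Hom X (reindex cl r (sR A))) :
    rlift s (sR A) ∘ (rlift t (reindex cl s (sR A)) ∘
      sval (sq ∘ fmap (reindex cl s') k)) = rlift r (sR A) ∘ sval k ∘ rlift s' X.
  by rewrite -(compA (rlift r _)) -rliftE (compA (rlift r _)) -sqE /= !compA.
have epsE (k : Hom X (reindex cl r (sR A))) :
    rlift t A ∘ sval (fmap (reindex cl t) eps ∘ sq ∘ fmap (reindex cl s') k) =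
    sval eps ∘ (rlift t (reindex cl s (sR A)) ∘ sval (sq ∘ fmap (reindex cl s') k)).
  by rewrite [RHS]compA -rliftE /= !compA.
have [k1 [w1 [ak1 [aw1 [e1 e2]]]]] := ex _ (above_rlift t e).
have [k ek] := rlift_ex r (X := X) k1 ak1.
exists k; split.
- apply: (rlift_uniq t); rewrite epsE -e2; congr (_ ∘ _).
  apply: (cartesian_uniq (rlift_cartesian s (sR A)) (above_rlift t _) aw1).
  by rewrite wE ek e1.
- move=> k' e'; apply: (rlift_uniq r); rewrite ek.
  apply: (un _ _ _ _ ak1 (above_rlift r k') aw1 (above_rlift t _) e1 (wE k')).
  by rewrite e2 -epsE -e'.
Qed.

End Reindexing.
End FibredFibrationCategories.

Theorem mainTheorem4 (E B : Category) (fibE : MorClass E) (fibB : MorClass B)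
    (p : Functor E B) (hp : is_fibred_ttfc fibE fibB p) :
  (is_ttfc fibB /\ forall I : B, is_ttfc (fiber_fib p fibE I)) /\
  forall cl : Cleavage p,
    (forall (I J : B) (s : Hom I J),
       is_tt_functor (fiber_fib p fibE J) (fiber_fib p fibE I) (reindex cl s)) /\
    (forall (I J : B) (s : Hom I J), acyclic_cof fibB s ->
       forall (X Y : fiber p J) (f : Hom X Y),
         fiber_fib p fibE J X Y f -> weakly_cartesian (reindex cl s) f) /\
    (forall (I J : B) (s : Hom I J), fibB I J s ->
       exists (sR : Functor (fiber p I) (fiber p J)),
         inhabited (Adjunction (reindex cl s) sR) /\
         preserves_fib (fiber_fib p fibE I) (fiber_fib p fibE J) sR) /\
    (forall (I J I' J' : B) (s : Hom I J) (r : Hom J' J) (t : Hom I' I)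
       (s' : Hom I' J') (hs : fibB I J s) (pb : is_pullback t s' s r)
       (sR : Functor (fiber p I) (fiber p J)) (adj : Adjunction (reindex cl s) sR)
       (sR' : Functor (fiber p I') (fiber p J'))
       (adj' : Adjunction (reindex cl s') sR'),
       is_nat_iso (beck_chevalley (proj1 pb) adj adj')).
Proof.
split.
- split; first exact: (ttf_cod (fttfc_tt_functor hp)).
  exact: (fiber_ttfc hp).
- move=> cl; split; last split; last split.
  + by move=> I J s; apply: (reindex_tt_functor hp).
  + by move=> I J s hs X Y f; apply: (reindex_weakly_cartesian hp).
  + move=> I J s hs; have [sR [adj]] := reindex_right_adjoint_ex hp cl s hs.
    by exists sR; split; [split | apply: (right_adjoint_preserves_fib hp cl s adj)].
  + move=> I J I' J' s r t s' hs pb sR adj sR' adj'.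
    exact: (beck_chevalley_iso hp cl hs pb adj adj').
Qed.
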